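(* Let $T$ be a quaternionic torus. The group $Aut(T)$ of biregular automorphisms of $T$ contains a subgroup isomorphic to $2C_3$ if and only if there exist $I\in\mathbb S$ and a quaternion $\alpha_3$ with $|\alpha_3|\ge1$ such that $(e^{\frac{\pi I}{3}},\alpha_3,\alpha_3e^{\frac{\pi I}{3}})$ is (a representative of) the modulus of $T$.
   Context: $\mathbb H\cong\mathbb R^4$ is the skew field of quaternions with its Euclidean scalar product $\langle\cdot,\cdot\rangle$ and norm $|\cdot|$; $\mathbb S=\{q\in\mathbb H: q^2=-1\}$, $\mathbb S^3=\{q\in\mathbb H:|q|=1\}$, and $e^{\alpha I}=\cos\alpha+I\sin\alpha$ for $I\in\mathbb S$. A function $f:\Omega\to\mathbb H$ on a domain $\Omega\subseteq\mathbb H$ is (slice) regular if for every $I\in\mathbb S$ its restriction $f_I$ to $\Omega\cap(\mathbb R+I\mathbb R)$ has continuous derivatives and $\frac12\left(\frac{\partial}{\partial x}+I\frac{\partial}{\partial y}\right)f_I(x+Iy)=0$. A rank-4 lattice in $\mathbb H$ is the additive subgroup generated by four $\mathbb R$-linearly independent elements. A quaternionic torus is a quotient $T=\mathbb H/L$, $L$ a rank-4 lattice, with the atlas of local inverses of the projection $\pi:\mathbb H\to\mathbb H/L$ on small connected open sets. A map between two quaternionic tori is regular if its expressions in these charts are slice regular; a biregular diffeomorphism is a bijective regular map with regular inverse. Two tori are equivalent if there is a biregular diffeomorphism of one onto the other. For $T=\mathbb H/L$, $Aut(T)$ is the group (under composition) of maps $F(q)=qa$ with $a\in\mathbb S^3$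 and $F(L)=L$. The Gram matrix of an (ordered) basis $\{v_1,v_2,v_3,v_4\}$ of a rank-4 lattice is $(\langle v_i,v_j\rangle)_{i,j}$. A Gram matrix $R=(r_{i,j})$ is reduced (in the sense of Minkowski–Siegel) if and only if: B1) $r_{k,k+1}\ge 0$ for $k=1,2,3$; B2) for each $k=1,2,3,4$, $n R\,{}^tn\ge r_{k,k}$ for every $n=(n_1,n_2,n_3,n_4)\in\mathbb Z^4$ such that $\gcd(n_k,\dots,n_4)=1$. A special basis is a basis whose Gram matrix is reduced and whose first element is $1$. $\mathcal M=\{(v_2,v_3,v_4)\in\mathbb H^3:\{1,v_2,v_3,v_4\}\text{ is a special basis}\}$. A triple $(v_2,v_3,v_4)$ is (a representative of) the modulus of $T$ if $(v_2,v_3,v_4)\in\mathcal M$ and $T$ is equivalent to $\mathbb H/(\mathbb Z+\mathbb Zv_2+\mathbb Zv_3+\mathbb Zv_4)$. $2C_3$ is the cyclic group of order $6$ generated in $\mathbb S^3$ by $e^{\pi I/3}$, $I\in\mathbb S$. *)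

(* Defs.v *)
From HB Require Import structures.
From mathcomp Require Import all_boot all_order all_algebra.
From mathcomp Require Import generic_quotient ring.
From mathcomp Require Import all_classical all_reals all_analysis.

Set Implicit Arguments.
Unset Strict Implicit.
Unset Printing Implicit Defensive.

Import Order.TTheory GRing.Theory Num.Theory.
Import numFieldNormedType.Exports.

Local Open Scope classical_set_scope.
Local Open Scope ring_scope.
Local Open Scope quotient_scope.

(* The row (a, b, c, d) stands for a + bi + cj + dk.  The topology and the real
   vector space structure are those of 'rV[R]_4; since the norm `|q| inherited
   from 'rV[R]_4 is the sup norm, the Euclidean norm is defined below as qnorm. *)
Definition quat (R : realType) := 'rV[R]_4.

HB.instance Definition _ (R : realType) := NormedModule.copy (quat R) 'rV[R]_4.
HB.instance Definition _ (R : realType) := Vector.copy (quat R) 'rV[R]_4.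

Definition mkquat (R : realType) (a b c d : R) : quat R :=
  \row_(i < 4) [:: a; b; c; d]`_i.

Section QuatRing.
Variable R : realType.
Implicit Types p q r : quat R.

Definition qcoef q (n : nat) : R := q 0 (inord n).

Definition qone : quat R := mkquat 1 0 0 0.

Definition qmul p q : quat R :=
  let a := qcoef p in let b := qcoef q in
  mkquat (a 0%N * b 0%N - a 1%N * b 1%N - a 2%N * b 2%N - a 3%N * b 3%N)
         (a 0%N * b 1%N + a 1%N * b 0%N + a 2%N * b 3%N - a 3%N * b 2%N)
         (a 0%N * b 2%N - a 1%N * b 3%N + a 2%N * b 0%N + a 3%N * b 1%N)
         (a 0%N * b 3%N + a 1%N * b 2%N - a 2%N * b 1%N + a 3%N * b 0%N).

Lemma quatP p q : (forall n, (n < 4)%N -> qcoef p n = qcoef q n) -> p = q.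
Proof.
move=> h; apply/rowP => i.
by have := h i (ltn_ord i); rewrite /qcoef inord_val.
Qed.

Lemma qcoefE a b c d n :
  (n < 4)%N -> qcoef (mkquat a b c d) n = [:: a; b; c; d]`_n.
Proof. by move=> n4; rewrite /qcoef mxE inordK. Qed.

Lemma qcoefD p q n : qcoef (p + q) n = qcoef p n + qcoef q n.
Proof. by rewrite /qcoef mxE. Qed.

Lemma qcoefZ (a : R) q n : qcoef (a *: q) n = a * qcoef q n.
Proof. by rewrite /qcoef mxE. Qed.

Local Ltac quat_ring :=
  apply: quatP => -[|[|[|[|//]]]] _; rewrite ?(qcoefE, qcoefD, qcoefZ) //=; ring.

Lemma qmulA : associative qmul.
Proof. by move=> p q r; quat_ring. Qed.

Lemma qmul1q : left_id qone qmul.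
Proof. by move=> q; quat_ring. Qed.

Lemma qmulq1 : right_id qone qmul.
Proof. by move=> q; quat_ring. Qed.

Lemma qmulDl : left_distributive qmul +%R.
Proof. by move=> p q r; quat_ring. Qed.

Lemma qmulDr : right_distributive qmul +%R.
Proof. by move=> p q r; quat_ring. Qed.

Lemma qone_neq0 : qone != 0.
Proof.
apply/eqP => /(congr1 (fun q : quat R => qcoef q 0)).
by rewrite qcoefE //= /qcoef mxE => /eqP; rewrite oner_eq0.
Qed.

HB.instance Definition _ :=
  GRing.Zmodule_isNzRing.Build (quat R) qmulA qmul1q qmulq1 qmulDl qmulDr
    qone_neq0.

Lemma qscalerAl (a : R) p q : a *: (p * q) = (a *: p) * q.
Proof. by rewrite /GRing.mul /=; quat_ring. Qed.

HB.instance Definition _ := GRing.Lmodule_isLalgebra.Build R (quat R) qscalerAl.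

Lemma qscalerAr (a : R) p q : a *: (p * q) = p * (a *: q).
Proof. by rewrite /GRing.mul /=; quat_ring. Qed.

HB.instance Definition _ := GRing.Lalgebra_isAlgebra.Build R (quat R) qscalerAr.

End QuatRing.

Section Quaternions.
Variable R : realType.
Local Notation H := (quat R).

Definition qdot (p q : H) : R := \sum_(i < 4) p 0 i * q 0 i.

Definition qnorm (q : H) : R := Num.sqrt (qdot q q).

Definition imag_units : set H := [set q | q ^+ 2 = -1].

Definition S3 : set H := [set q | qnorm q = 1].

Definition qexp (t : R) (I : H) : H := (cos t)%:A + sin t *: I.

Definition slice_pt (I : H) (z : R * R) : H := z.1%:A + z.2 *: I.

(* Only the values of f on the open set Omega matter.  Connectedness of Omega
   plays no role in the condition, hence is not imposed. *)
Definition slice_regular (Omega : set H) (f : H -> H) : Prop :=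
  forall I, imag_units I ->
  let f_I : R * R -> H := f \o slice_pt I in
  forall z : R * R, Omega (slice_pt I z) ->
    [/\ derivable f_I z (1, 0) /\ derivable f_I z (0, 1),
        {for z, continuous ('D_(1, 0) f_I)} /\
          {for z, continuous ('D_(0, 1) f_I)} &
        2^-1 *: ('D_(1, 0) f_I z + I * 'D_(0, 1) f_I z) = 0].

Definition zspan (b : 4.-tuple H) : set H :=
  [set q | exists n : 'I_4 -> int, q = \sum_(i < 4) tnth b i *~ n i].

Definition is_basis (b : 4.-tuple H) (L : set H) : Prop :=
  free b /\ L = zspan b.

Record lattice := Lattice {
  lattice_set :> set H;
  latticeP : exists b, is_basis b lattice_set }.

Lemma lattice0 (L : lattice) : lattice_set L 0.
Proof.
have [b [_ ->]] := latticeP L.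
by exists (fun=> 0); rewrite big1 // => i _; rewrite mulr0z.
Qed.

Lemma latticeB (L : lattice) p q :
  lattice_set L p -> lattice_set L q -> lattice_set L (p - q).
Proof.
have [b [_ ->]] := latticeP L => -[m ->] [n ->].
exists (fun i => m i - n i); rewrite -sumrB.
by apply: eq_bigr => i _; rewrite mulrzBr.
Qed.

Definition lattice_rel (L : lattice) : rel H :=
  fun p q => `[< lattice_set L (p - q) >].

Lemma lattice_rel_refl L : reflexive (lattice_rel L).
Proof. by move=> q; apply/asboolP; rewrite subrr; exact: lattice0. Qed.

Lemma lattice_rel_sym L : symmetric (lattice_rel L).
Proof.
move=> p q; apply: asbool_equiv_eq; split=> h;
  by rewrite -opprB -sub0r; apply: latticeB => //; exact: lattice0.
Qed.

Lemma lattice_rel_trans L : transitive (lattice_rel L).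
Proof.
move=> q p r /asboolP pq /asboolP qr; apply/asboolP.
have rq : lattice_set L (r - q).
  by rewrite -opprB -sub0r; apply: latticeB => //; exact: lattice0.
have -> : p - r = (p - q) - (r - q) by rewrite opprB addrA subrK.
exact: latticeB.
Qed.

Canonical lattice_equiv L : equiv_rel H :=
  EquivRel (lattice_rel L)
    (@lattice_rel_refl L) (@lattice_rel_sym L) (@lattice_rel_trans L).

Definition torus (L : lattice) := quotient_topology {eq_quot lattice_equiv L}.

Definition tproj (L : lattice) (q : H) : torus L := \pi_(torus L) q.

(* phi is a chart, with image V: a local inverse of the projection on V.  The
   existence of phi forces the projection to be injective on V, which is what
   "V small" means. *)
Definition is_chart (L : lattice) (V : set H) (phi : torus L -> H) : Prop :=
  [/\ open V, connected V & forall q, V q -> phi (tproj L q) = q].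

(* The expression of F in the charts phi1 = (tproj L1 on V1)^-1 and
   phi2 = (tproj L2 on V2)^-1 is phi2 \o F \o tproj L1, whose domain is the set
   of q in V1 such that F (tproj L1 q) is in tproj L2 @` V2; as for any map of
   manifolds, F is continuous, so that this domain is open. *)
Definition torus_regular (L1 L2 : lattice) (F : torus L1 -> torus L2) : Prop :=
  continuous F /\
  forall V1 phi1 V2 phi2, @is_chart L1 V1 phi1 -> @is_chart L2 V2 phi2 ->
    slice_regular [set q | V1 q /\ (tproj L2 @` V2) (F (tproj L1 q))]
                  (phi2 \o F \o tproj L1).

Definition biregular (L1 L2 : lattice) (F : torus L1 -> torus L2) : Prop :=
  torus_regular F /\
  exists G : torus L2 -> torus L1,
    [/\ cancel F G, cancel G F & torus_regular G].

Definition equivalent_tori (L1 L2 : lattice) : Prop :=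
  exists F : torus L1 -> torus L2, biregular F.

Definition Aut (L : lattice) : set (H -> H) :=
  [set F | exists a, [/\ S3 a, F = (fun q => q * a) &
                         F @` lattice_set L = lattice_set L]].

Definition gram (b : 4.-tuple H) : 'M[R]_4 :=
  \matrix_(i, j) qdot (tnth b i) (tnth b j).

(* Indices start at 0, so that n 0 j with k <= j runs through n_k, ..., n_4. *)
Definition reduced (G : 'M[R]_4) : Prop :=
  (forall i j : 'I_4, j = i.+1 :> nat -> 0 <= G i j) /\
  (forall (k : 'I_4) (n : 'rV[int]_4),
     \big[gcdz/0]_(j < 4 | (k <= j)%N) n 0 j = 1 ->
     let nR : 'rV[R]_4 := map_mx intr n in
     G k k <= (nR *m G *m nR^T) 0 0).

Definition special_basis (b : 4.-tuple H) : Prop :=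
  [/\ free b, reduced (gram b) & tnth b ord0 = 1].

Definition moduli : set (H * H * H) :=
  [set v | special_basis [tuple 1; v.1.1; v.1.2; v.2]].

Definition is_modulus (L : lattice) (v : H * H * H) : Prop :=
  moduli v /\
  exists L' : lattice,
    lattice_set L' = zspan [tuple 1; v.1.1; v.1.2; v.2] /\
    equivalent_tori L L'.

Definition twoC3 (I : H) : set H :=
  [set q | exists k : nat, q = qexp (pi / 3) I ^+ k].

Definition map_group (K : set (H -> H)) : Prop :=
  [/\ K id,
      forall F G, K F -> K G -> K (F \o G) &
      forall F, K F -> exists2 G, K G & cancel F G /\ cancel G F].

Definition has_subgroup_isog (A : set (H -> H)) (G : set H) : Prop :=
  exists (K : set (H -> H)) (phi : H -> (H -> H)),
    [/\ K `<=` A, map_group K, set_bij G K phi &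
        forall x y, G x -> G y -> phi (x * y) = phi x \o phi y].

End Quaternions.

(* Main.v *)
Require Import Defs.
From HB Require Import structures.
From mathcomp Require Import all_boot all_order all_algebra.
From mathcomp Require Import all_classical all_reals all_analysis.
From mathcomp Require Import ring lra zify.

Import Order.TTheory GRing.Theory Num.Theory.
Import numFieldNormedType.Exports.

Local Open Scope classical_set_scope.
Local Open Scope ring_scope.
Set Implicit Arguments.
Unset Strict Implicit.
Unset Printing Implicit Defensive.

(** Let e denote a root of u^2 - u + 1, that is a primitive sixth root of
    unity, or equivalently e = exp(pi I / 3) for an imaginary unit I
    (sixth_root_qexp).  The theorem says that L admits such a right multiplier
    exactly when L is, up to equivalence, Z[e] + alpha Z[e] with a reduced
    basis 1, e, alpha, alpha e.

    The group side is elementary (symmetry_of_subgroup, subgroup_of_symmetry).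
    If the automorphism q -> q a generates the given cyclic group of order 6,
    then a^3 has order 2, so a^3 = -1, and a <> -1; as the quaternions have no
    zero divisors, a^2 - a + 1 = 0.  Conversely the powers of a root u of
    u^2 - u + 1 preserving L form the required group.

    From a symmetry to a modulus (modulus_of_symmetry): multiply L on the right
    by the inverse of a shortest vector v.  The result M is an equivalent
    lattice whose shortest vectors have norm 1 and which contains Z[e], where
    e = v u v^-1.  Let alpha be a shortest vector of M outside Z[e].  Every
    point of the plane R + R e lies at squared distance at most 7/16 from Z[e];
    applying this to the component of a vector of M in that plane and to its
    component orthogonal to it, one reduces any vector modulo
    Z[e] + alpha Z[e] to a vector shorter than alpha, hence in Z[e]
    (module_eq_zspan).  The Minkowski inequalities are then immediate: the
    coprimality condition makes the vector nonzero, respectively outside Z[e]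
    (basis4_special).

    From a modulus to a symmetry (symmetry_of_modulus): Z[e] + alpha Z[e] is
    stable under right multiplication by e, and the point is to transport this
    along a biregular map.  This is possible because a regular map F between
    tori lifts to an affine map q -> p + q a (torus_regular_affine).  For small
    real h let D(q) be the small displacement from F(q) to F(q + h).  Real
    translations preserve all slices, so D is slice regular although general
    translations destroy slice regularity; it is continuous and periodic, so
    its norm attains a maximum.  By the mean value property on circles
    (max_circle) D is constant on a slice through the maximum.  All slices
    share the real axis, so the maximum is attained on each of them, and D is
    constant (max_const).  Therefore local lifts of F have the same constant
    derivative a along the real axis, and I a along I by the Cauchy-Riemann
    equation.  Taking differences rather than derivatives of F keeps the
    argument within the C^1 regularity that slice regularity grants, and
    working with local lifts makes a global lift unnecessary. *)

(** * Derivatives and the maximum principle in the plane *)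

Section HarmonicMax.
Variable R : realType.
Implicit Types (u v ux uy vx vy : R * R -> R).

(** The mean value theorem with no order imposed on a and b, and with the
    intermediate point located by its distance to a, so that it tends to a
    when b does. *)
Lemma MVT_between (f df : R -> R) (a b : R) :
  (forall x : R, `|x - a| <= `|b - a| -> is_derive x 1 f (df x)) ->
  exists c, `|c - a| <= `|b - a| /\ f b - f a = df c * (b - a).
Proof.
move=> fdf.
have cf (x y : R) : (forall t, x <= t <= y -> `|t - a| <= `|b - a|) ->
    {within `[x, y], continuous f}.
  move=> xy; apply: derivable_within_continuous => t; rewrite in_itv/= => txy.
  by case: (fdf t (xy t txy)).
have [ab|ba] := leP a b.
  have ab' t : a <= t <= b -> `|t - a| <= `|b - a|.
    by move=> /andP[? ?]; rewrite !ger0_norm ?subr_ge0//; lra.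
  have D (x : R) : x \in `]a, b[%R -> is_derive x 1 f (df x).
    by rewrite in_itv/= => /andP[ax xb]; apply/fdf/ab'; rewrite !ltW.
  have [c] := MVT_segment ab D (cf a b ab').
  by rewrite in_itv /= => /ab' acb E; exists c.
have ba' t : b <= t <= a -> `|t - a| <= `|b - a|.
  by move=> /andP[? ?]; rewrite !ler0_norm ?subr_le0 ?(ltW ba)//; lra.
have D (x : R) : x \in `]b, a[%R -> is_derive x 1 f (df x).
  by rewrite in_itv/= => /andP[ax xb]; apply/fdf/ba'; rewrite !ltW.
have [c] := MVT_segment (ltW ba) D (cf b a ba').
rewrite in_itv /= => /ba' bca E; exists c; split => //.
by rewrite -opprB E -mulrN opprB.
Qed.

Lemma derive_zero_const (f : R -> R) (s0 s e : R) :
  (forall t, `|t - s0| < e -> is_derive t 1 f 0) -> `|s - s0| < e -> f s = f s0.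
Proof.
move=> fd se; apply/eqP; rewrite -subr_eq0; apply/eqP.
have [|c [_ ->]] := @MVT_between f (fun=> 0) s0 s; last by rewrite mul0r.
by move=> x xs; apply: fd; exact: le_lt_trans se.
Qed.

Lemma is_derive_partial1 u ux (x y : R) :
  is_derive (x, y) (1, 0) u (ux (x, y)) ->
  is_derive x 1 (fun s => u (s, y)) (ux (x, y)).
Proof.
have E : (fun h : R => h^-1 *: ((u \o shift (x, y)) (h *: (1, 0)) - u (x, y)))
  = (fun h : R => h^-1 *: (((fun s => u (s, y)) \o shift x) (h *: 1) - u (x, y))).
  apply/funext => h /=; congr (_ *: (u _ - _)).
  by rewrite /GRing.scale/= /scale_pair/= !/GRing.scale /= mulr0; congr pair; rewrite /= add0r.
move=> [d e]; split.
  by move: d; rewrite /derivable E.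
by move: e; rewrite /derive E.
Qed.

Lemma is_derive_partial2 u uy (x y : R) :
  is_derive (x, y) (0, 1) u (uy (x, y)) ->
  is_derive y 1 (fun s => u (x, s)) (uy (x, y)).
Proof.
have E : (fun h : R => h^-1 *: ((u \o shift (x, y)) (h *: (0, 1)) - u (x, y)))
  = (fun h : R => h^-1 *: (((fun s => u (x, s)) \o shift y) (h *: 1) - u (x, y))).
  apply/funext => h /=; congr (_ *: (u _ - _)).
  by rewrite /GRing.scale/= /scale_pair/= !/GRing.scale /= mulr0; congr pair; rewrite /= add0r.
move=> [d e]; split.
  by move: d; rewrite /derivable E.
by move: e; rewrite /derive E.
Qed.

Lemma is_derive_cvg (f : R -> R) (t df : R) :
  is_derive t 1 f df -> h^-1 * (f (h + t) - f t) @[h --> 0^'] --> df.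
Proof.
move=> [d <-]; suff -> : (fun h => h^-1 * (f (h + t) - f t)) =
  (fun h => h^-1 *: ((f \o shift t) (h *: 1) - f t)) by exact: d.
by apply/funext => h /=; rewrite /GRing.scale/= mulr1.
Qed.

Lemma cvg_is_derive (f : R -> R) (t df : R) :
  h^-1 * (f (h + t) - f t) @[h --> 0^'] --> df -> is_derive t 1 f df.
Proof.
have -> : (fun h => h^-1 * (f (h + t) - f t)) =
  (fun h => h^-1 *: ((f \o shift t) (h *: 1) - f t)).
  by apply/funext => h /=; rewrite /GRing.scale/= mulr1.
by move=> c; split; [exact: cvgP c|exact: cvg_lim c].
Qed.

(** The chain rule along a plane curve.  Continuous partial derivatives are
    enough: the increment of u is split into a horizontal and a vertical one,
    the mean value theorem applies to each, and the intermediate points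
    converge to the base point. *)
Lemma C1_chain u ux uy (f g : R -> R) (t df dg : R) :
  (forall z : R * R, is_derive z (1, 0) u (ux z)) ->
  (forall z : R * R, is_derive z (0, 1) u (uy z)) ->
  continuous ux -> continuous uy ->
  is_derive t 1 f df -> is_derive t 1 g dg ->
  is_derive t 1 (fun s => u (f s, g s))
    (ux (f t, g t) * df + uy (f t, g t) * dg).
Proof.
move=> hx hy cx cy hf hg.
have cfg (k : R -> R) dk : is_derive t 1 k dk -> k (h + t) @[h --> 0^'] --> k t.
  move=> hk; have kt : {for t, continuous k}.
    by apply/differentiable_continuous/derivable1_diffP; case: hk.
  have c0 : k (h + t) @[h --> 0] --> k t.
    apply: (@continuous_cvg _ _ _ _ _ (fun h => h + t) k t); first exact: kt.
    by rewrite -[X in _ --> X]add0r; apply: cvgD; [exact: cvg_id|exact: cvg_cst].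
  exact: (cvg_trans (cvg_app _ (nbhs_dnbhs (x := 0))) c0).
have /choice[a Ha] : forall h, exists c, `|c - f t| <= `|f (h + t) - f t| /\
   u (f (h + t), g (h + t)) - u (f t, g (h + t)) =
     ux (c, g (h + t)) * (f (h + t) - f t).
  move=> h; apply: (MVT_between (f := fun s => u (s, g (h + t)))
    (df := fun s => ux (s, g (h + t)))) => x _.
  exact: is_derive_partial1.
have /choice[b Hb] : forall h, exists c, `|c - g t| <= `|g (h + t) - g t| /\
   u (f t, g (h + t)) - u (f t, g t) =
     uy (f t, c) * (g (h + t) - g t).
  move=> h; apply: (MVT_between (f := fun s => u (f t, s))
    (df := fun s => uy (f t, s))) => x _.
  exact: is_derive_partial2.
apply: cvg_is_derive.
have -> : (fun h => h^-1 * (u (f (h + t), g (h + t)) - u (f t, g t))) =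
  (fun h => ux (a h, g (h + t)) * (h^-1 * (f (h + t) - f t)) +
    uy (f t, b h) * (h^-1 * (g (h + t) - g t))).
  apply/funext => h.
  have [_ E1] := Ha h; have [_ E2] := Hb h.
  rewrite -(subrKA (u (f t, g (h + t)))) E1 E2; ring.
have sq (k c : R -> R) dk : is_derive t 1 k dk ->
    (forall h, `|c h - k t| <= `|k (h + t) - k t|) -> c h @[h --> 0^'] --> k t.
  move=> /cfg kt ck; apply/cvgrPdist_le => e e0.
  move/cvgrPdist_le : kt => /(_ e e0); apply: filterS => h.
  rewrite distrC => H; rewrite distrC; exact: le_trans (ck h) H.
apply: cvgD; apply: cvgM; try exact: is_derive_cvg.
  have c1 : (a h, g (h + t)) @[h --> 0^'] --> (f t, g t).
    apply: (@cvg_pair R R R _ (nbhs (f t)) (nbhs (g t)) _ _ _ a (fun h => g (h + t))).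
      by apply: (sq f _ df) => // h; case: (Ha h).
    exact: cfg hg.
  exact: (cvg_comp _ _ c1 (cx _)).
have c2 : (f t, b h) @[h --> 0^'] --> (f t, g t).
  apply: (@cvg_pair R R R _ (nbhs (f t)) (nbhs (g t)) _ _ _ (fun=> f t) b).
    exact: cvg_cst.
  by apply: (sq g _ dg) => // h; case: (Hb h).
exact: (cvg_comp _ _ c2 (cy _)).
Qed.

Lemma is_derive_lin_comp (c k : R) (f : R -> R) (t df : R) :
  is_derive t 1 f df -> is_derive t 1 (fun s => c + k * f s) (k * df).
Proof.
move=> hf; have -> : (fun s => c + k * f s) = cst c + k \*: f by [].
have := is_deriveD (is_derive_cst c t 1) (is_deriveZ k hf).
by rewrite add0r.
Qed.

Lemma is_derive_affine (c k t : R) : is_derive t 1 (fun s => c + s * k) k.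
Proof.
rewrite (_ : (fun _ => _) = (fun s => c + k * s)); last first.
  by apply/funext => s; rewrite mulrC.
by have := is_derive_lin_comp c k (is_derive_id t 1); rewrite mulr1.
Qed.

Definition circle_pt (z : R * R) (r t : R) : R * R :=
  (z.1 + r * cos t, z.2 + r * sin t).

Section CircleMean.
Variables (u v ux uy : R * R -> R).
Hypothesis u_x : forall z : R * R, is_derive z (1, 0) u (ux z).
Hypothesis u_y : forall z : R * R, is_derive z (0, 1) u (uy z).
Hypothesis v_x : forall z : R * R, is_derive z (1, 0) v (- uy z).
Hypothesis v_y : forall z : R * R, is_derive z (0, 1) v (ux z).
Hypothesis cux : continuous ux.
Hypothesis cuy : continuous uy.
Variable z : R * R.

(** The derivative in r of u along the rays from z. *)
Definition radial (p : R * R) : R :=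
  ux (circle_pt z p.1 p.2) * cos p.2 + uy (circle_pt z p.1 p.2) * sin p.2.

Lemma circle_pt_continuous : continuous (fun p : R * R => circle_pt z p.1 p.2).
Proof.
move=> p; apply: (@cvg_pair _ R R _ (nbhs _) (nbhs _) _ _ _
  (fun p => z.1 + p.1 * cos p.2) (fun p => z.2 + p.1 * sin p.2)) => /=.
  apply: cvgD; first exact: cvg_cst.
  apply: cvgM; first exact: cvg_fst.
  by apply: (@continuous_comp _ _ _ snd cos); [exact: cvg_snd|exact: continuous_cos].
apply: cvgD; first exact: cvg_cst.
apply: cvgM; first exact: cvg_fst.
by apply: (@continuous_comp _ _ _ snd sin); [exact: cvg_snd|exact: continuous_sin].
Qed.

Lemma radial_continuous : continuous radial.
Proof.
move=> p; apply: cvgD; apply: cvgM.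
- by apply: (@continuous_comp _ _ _ (fun p : R * R => circle_pt z p.1 p.2) ux);
    [exact: circle_pt_continuous|exact: cux].
- by apply: (@continuous_comp _ _ _ snd cos); [exact: cvg_snd|exact: continuous_cos].
- by apply: (@continuous_comp _ _ _ (fun p : R * R => circle_pt z p.1 p.2) uy);
    [exact: circle_pt_continuous|exact: cuy].
- by apply: (@continuous_comp _ _ _ snd sin); [exact: cvg_snd|exact: continuous_sin].
Qed.

Lemma pairr_continuous (r : R) : continuous (fun t : R => (r, t)).
Proof.
move=> t; apply: (@cvg_pair _ R R _ (nbhs _) (nbhs _) _ _ _ (fun=> r) id).
  exact: cvg_cst.
exact: cvg_id.
Qed.

Lemma radial_derive (r t : R) :
  is_derive r (1 : R) (fun s => u (circle_pt z s t)) (radial (r, t)).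
Proof.
rewrite /radial/= /circle_pt.
have := C1_chain (f := fun s => z.1 + s * cos t) (g := fun s => z.2 + s * sin t)
  (t := r) (df := cos t) (dg := sin t) u_x u_y cux cuy.
apply; apply: is_derive_affine.
Qed.

(** The Cauchy-Riemann equations turn the angular derivative of v into r times
    the radial derivative of u. *)
Lemma angular_derive (r t : R) :
  is_derive t (1 : R) (fun s => v (circle_pt z r s)) (r * radial (r, t)).
Proof.
rewrite /radial/= /circle_pt.
have := C1_chain (f := fun s => z.1 + r * cos s) (g := fun s => z.2 + r * sin s)
  (t := t) (df := r * - sin t) (dg := r * cos t) v_x v_y.
have cuyN : continuous (fun z => - uy z) by move=> p; apply: cvgN; exact: cuy.
move=> /(_ cuyN cux (is_derive_lin_comp _ _ (is_derive_cos t))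
  (is_derive_lin_comp _ _ (is_derive_sin t))).
by congr (is_derive _ _ _ _); ring.
Qed.

Local Notation mu := (@lebesgue_measure R).
Local Notation I2pi := (`[0, pi *+ 2]%classic : set R).

Lemma pi2_gt0 : 0 < pi *+ 2 :> R.
Proof. by rewrite mulrn_wgt0// pi_gt0. Qed.

Lemma integral_closed_derivative (f F : R -> R) : continuous f ->
  (forall t : R, is_derive t (1 : R) F (f t)) -> F 0 = F (pi *+ 2) ->
  \int[mu]_(t in I2pi) f t = 0.
Proof.
move=> cf dF F02.
have cF : continuous F.
  by move=> x; apply/differentiable_continuous/derivable1_diffP; case: (dF x).
rewrite /Rintegral (continuous_FTC2 (F := F)) ?F02 ?subee//.
- exact: pi2_gt0.
- exact: continuous_subspaceT.
- split.
  + by move=> x _; case: (dF x).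
  + exact/cvg_at_right_filter/cF.
  + exact/cvg_at_left_filter/cF.
- by move=> x _; rewrite derive1E; case: (dF x).
Qed.

(** For r <> 0 the integrand is the derivative of v / r along the circle.  At the
    centre, where this fails, it is a combination of cos and sin with constant
    coefficients. *)
Lemma radial_integral0 (r : R) : \int[mu]_(t in I2pi) radial (r, t) = 0.
Proof.
have c s : continuous (fun t => radial (s, t)).
  by move=> t; apply: (@continuous_comp _ _ _ (fun t => (s, t)) radial);
   [exact: pairr_continuous|exact: radial_continuous].
have [->|r0] := eqVneq r 0.
  have z0 t : circle_pt z 0 t = z by rewrite /circle_pt !mul0r !addr0; case: z.
  apply: (integral_closed_derivative (F := fun t => (0 + ux z * sin t) - (0 + uy z * cos t))).
  - exact: c.
  - move=> t; rewrite (_ : radial (0, t) = ux z * cos t - uy z * - sin t).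
      exact: is_deriveB (is_derive_lin_comp 0 (ux z) (is_derive_sin t))
        (is_derive_lin_comp 0 (uy z) (is_derive_cos t)).
    by rewrite /radial/= z0; ring.
  - by rewrite sin0 cos0 mulr2n sinDpi cosDpi sinpi cospi opprK oppr0.
apply: (integral_closed_derivative (F := fun t => 0 + r^-1 * v (circle_pt z r t))).
- exact: c.
- move=> t; have := is_derive_lin_comp 0 r^-1 (angular_derive r t).
  by congr (is_derive _ _ _ _); rewrite mulKf.
- by rewrite /circle_pt sin0 cos0 mulr2n sinDpi cosDpi sinpi cospi opprK oppr0.
Qed.

Lemma u_circle_continuous r : continuous (fun t => u (circle_pt z r t)).
Proof.
move=> t; have := C1_chain u_x u_y cux cuy (is_derive_lin_comp z.1 r (is_derive_cos t))
  (is_derive_lin_comp z.2 r (is_derive_sin t)).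
by move=> [H _]; apply/differentiable_continuous/derivable1_diffP.
Qed.

Lemma integrable_segment (f : R -> R) (a b : R) :
  continuous f -> mu.-integrable `[a, b] (EFin \o f).
Proof.
move=> cf; apply: continuous_compact_integrable; first exact: segment_compact.
exact: continuous_subspaceT.
Qed.

(** Differentiation under the integral sign; on the compact rectangle where |s - r|
    is at most 1 the radial derivative is bounded by a constant. *)
Lemma circle_mean_derive (r : R) :
  is_derive r 1 (fun r => \int[mu]_(t in I2pi) u (circle_pt z r t)) 0.
Proof.
pose f (s t : R) := u (circle_pt z s t).
have [C C0 HC] : exists2 C, 0 <= C & forall s t,
    r - 1 <= s <= r + 1 -> I2pi t -> `|radial (s, t)| <= C.
  have cK : compact (`[r - 1, r + 1] `*` I2pi).
    by apply: compact_setX; exact: segment_compact.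
  have K0 : (`[r - 1, r + 1] `*` I2pi) !=set0.
    by exists (r, 0); split; rewrite /= in_itv/= ?lexx ?(ltW pi2_gt0)//; lra.
  have cr : {within (`[r - 1, r + 1] `*` I2pi), continuous (fun p => `|radial p|)}.
    apply: continuous_subspaceT => p.
    by apply: (@continuous_comp _ _ _ radial Num.norm);
      [exact: radial_continuous|exact: norm_continuous].
  have [c _ Hc] := compact_EVT_max K0 cK cr.
  exists `|radial c| => // s t rs It; apply: (Hc (s, t)); rewrite inE; split => //.
have d1f s t : is_derive s (1 : R) (f ^~ t) (radial (s, t)) by exact: radial_derive.
have d1E s t : partial1of2 f s t = radial (s, t).
  by rewrite partial1of2E; case: (d1f s t).
have rI : (`]r - 1, r + 1[%classic : set R) r by rewrite /= in_itv/=; lra.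
have intf x : `]r - 1, r + 1[%classic x -> mu.-integrable I2pi (EFin \o f x).
  by move=> _; apply: integrable_segment; exact: u_circle_continuous.
have derf x y : `]r - 1, r + 1[%classic x -> I2pi y -> derivable (f ^~ y) x 1.
  by move=> _ _; case: (d1f x y).
have iG : mu.-integrable I2pi (EFin \o (fun=> C)).
  by apply: integrable_segment; exact: cst_continuous.
have Gub x y : `]r - 1, r + 1[%classic x -> I2pi y -> `|partial1of2 f x y| <= C.
  rewrite /= in_itv/= => /andP[x1 x2] Iy; rewrite d1E; apply: HC => //.
  by rewrite !ltW.
have dU := derivable_under_integral (mu := mu) (measurable_itv _) rI intf derf
  (fun=> C0) iG Gub.
have vU := differentiation_under_integral (mu := mu) (measurable_itv _) rI intf
  derf (fun=> C0) iG Gub.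
split; first exact: dU.
rewrite -derive1E vU -[RHS](radial_integral0 r).
by apply: eq_Rintegral => t _; rewrite d1E.
Qed.

Lemma circle_mean (r : R) :
  \int[mu]_(t in I2pi) u (circle_pt z r t) = \int[mu]_(t in I2pi) u z.
Proof.
rewrite (is_derive_0_is_cst r 0 circle_mean_derive).
by apply: eq_Rintegral => t _; rewrite /circle_pt !mul0r !addr0; case: z.
Qed.

Lemma continuous_integral0 (f : R -> R) t : continuous f -> (forall s, 0 <= f s) ->
  \int[mu]_(s in I2pi) f s = 0 -> 0 < t < pi *+ 2 -> f t = 0.
Proof.
move=> cf f0 intf /andP[t0 t1].
apply/eqP; rewrite eq_le f0 andbT leNgt; apply/negP => ft.
(* if f t > 0, the interval of radius d below contributes at least f t * d *)
have [e e0 He] : exists2 e, 0 < e & forall s, t - e <= s <= t + e -> f t / 2 <= f s.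
  have /(_ _ (f t / 2)) := (cvgrPdist_lt _ _).1 (cf t).
  rewrite divr_gt0// => /(_ isT) /nbhs_ballP[e /= e0 He].
  exists (e / 2); first by rewrite divr_gt0.
  move=> s ts; have : `|f t - f s| < f t / 2.
    by apply: He; rewrite /ball/= ltr_distlC; lra.
  by rewrite ltr_distlC => /andP[]; lra.
pose d := Num.min e (Num.min t (pi *+ 2 - t)).
have d0 : 0 < d by rewrite !lt_min e0 t0 subr_gt0.
have de : d <= e by rewrite ge_min lexx.
have dt : d <= t by rewrite !ge_min lexx !orbT.
have dt2 : d <= pi *+ 2 - t by rewrite !ge_min lexx !orbT.
have JI : `[t - d, t + d]%classic `<=` I2pi.
  by move=> s; rewrite /= !in_itv/= => /andP[? ?]; apply/andP; split; lra.
have iI := integrable_segment 0 (pi *+ 2) cf.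
have iJ := integrable_segment (t - d) (t + d) cf.
have : (f t / 2) * (d *+ 2) <= \int[mu]_(s in `[t - d, t + d]) f s.
  have -> : f t / 2 * (d *+ 2) = \int[mu]_(s in `[t - d, t + d]) (f t / 2).
    have muJ : mu `[t - d, t + d]%classic = (d *+ 2)%:E.
      rewrite lebesgue_measure_itv/= lte_fin ifT; last by lra.
      by rewrite -EFinD; congr (_%:E); rewrite mulr2n; ring.
    rewrite (Rintegral_cst mu (measurable_itv _)).
    exact: (congr1 (fun x => f t / 2 * fine x) (esym muJ)).
  apply: le_Rintegral => //; last first.
    move=> s; rewrite /= in_itv/= => /andP[? ?]; apply: He; apply/andP; split; lra.
  by apply: integrable_segment; exact: cst_continuous.
have : \int[mu]_(s in `[t - d, t + d]) f s <= \int[mu]_(s in I2pi) f s.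
  rewrite /Rintegral fine_le//.
  - exact: integrable_fin_num.
  - exact: integrable_fin_num.
  - apply: ge0_subset_integral => //; first by case/integrableP : iI.
    by move=> s _; rewrite lee_fin.
rewrite intf => h1 h2; have := le_trans h2 h1.
by apply/negP; rewrite -ltNge mulr_gt0 ?mulrn_wgt0 ?divr_gt0.
Qed.

End CircleMean.

(** The maximum principle for the real part u of a holomorphic function: its
    mean on each circle around z is its maximum u z, which forces u to be u z
    on the whole circle.  Negative radii are allowed, so that every direction is
    met by an angle strictly between 0 and 2 pi. *)
Lemma max_circle (u v ux uy : R * R -> R) (z : R * R) (r t : R) :
  (forall z : R * R, is_derive z (1, 0) u (ux z)) ->
  (forall z : R * R, is_derive z (0, 1) u (uy z)) ->
  (forall z : R * R, is_derive z (1, 0) v (- uy z)) ->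
  (forall z : R * R, is_derive z (0, 1) v (ux z)) ->
  continuous ux -> continuous uy ->
  (forall w, u w <= u z) -> 0 < t < pi *+ 2 -> u (circle_pt z r t) = u z.
Proof.
move=> u_x u_y v_x v_y cux cuy uM t2.
have cu : continuous (fun t => u (circle_pt z r t)) by exact: u_circle_continuous.
apply/esym/eqP; rewrite -subr_eq0; apply/eqP.
apply: (continuous_integral0 (f := fun t => u z - u (circle_pt z r t))) => //.
- by move=> s; apply: cvgB; [exact: cvg_cst|exact: cu].
- by move=> s; rewrite subr_ge0.
- rewrite RintegralB//; first last.
  + by apply: integrable_segment.
  + by apply: integrable_segment; exact: cst_continuous.
  by rewrite (circle_mean u_x u_y v_x v_y cux cuy) subrr.
Qed.

End HarmonicMax.

(** * Quaternions *)

Section QuaternionAlgebra.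
Variable R : realType.
Local Notation H := (quat R).
Implicit Types p q r I : H.

Lemma qcoefN q n : qcoef (- q) n = - qcoef q n.
Proof. by rewrite /qcoef mxE. Qed.

Lemma qcoefB p q n : qcoef (p - q) n = qcoef p n - qcoef q n.
Proof. by rewrite qcoefD qcoefN. Qed.

Lemma qcoef0 n : qcoef (0 : H) n = 0.
Proof. by rewrite /qcoef mxE. Qed.

Lemma qcoef1 n : (n < 4)%N -> qcoef (1 : H) n = (n == 0%N)%:R.
Proof. by move=> n4; rewrite /GRing.one/= /qone qcoefE//; case: n n4 => [|[|[|[|]]]]. Qed.

Lemma qcoefM p q n : (n < 4)%N -> qcoef (p * q) n =
  [:: qcoef p 0 * qcoef q 0 - qcoef p 1 * qcoef q 1 - qcoef p 2 * qcoef q 2 - qcoef p 3 * qcoef q 3;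
      qcoef p 0 * qcoef q 1 + qcoef p 1 * qcoef q 0 + qcoef p 2 * qcoef q 3 - qcoef p 3 * qcoef q 2;
      qcoef p 0 * qcoef q 2 - qcoef p 1 * qcoef q 3 + qcoef p 2 * qcoef q 0 + qcoef p 3 * qcoef q 1;
      qcoef p 0 * qcoef q 3 + qcoef p 1 * qcoef q 2 - qcoef p 2 * qcoef q 1 + qcoef p 3 * qcoef q 0]`_n.
Proof. by move=> n4; rewrite {1}/GRing.mul/= /qmul qcoefE. Qed.

Definition qconj q : H := mkquat (qcoef q 0) (- qcoef q 1) (- qcoef q 2) (- qcoef q 3).

Lemma qcoef_conj q n : (n < 4)%N -> qcoef (qconj q) n =
  [:: qcoef q 0; - qcoef q 1; - qcoef q 2; - qcoef q 3]`_n.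
Proof. exact: qcoefE. Qed.

Lemma qdotE p q : qdot p q = qcoef p 0 * qcoef q 0 + qcoef p 1 * qcoef q 1 +
  qcoef p 2 * qcoef q 2 + qcoef p 3 * qcoef q 3.
Proof.
rewrite /qdot !big_ord_recr big_ord0/= add0r /qcoef.
by congr (_ + _ + _ + _); congr (_ * _); congr (_ _ _); apply/val_inj; rewrite /= inordK.
Qed.

Local Ltac qsimp := rewrite ?(qdotE, qcoefE, qcoefD, qcoefB, qcoefN, qcoefZ,
  qcoef0, qcoefM, qcoef1, qcoef_conj) //=.
Local Ltac quat_eq := apply: quatP => -[|[|[|[|//]]]] _; do 3 qsimp.

Lemma qdotC p q : qdot p q = qdot q p.
Proof. by rewrite !qdotE; ring. Qed.

Lemma qdotDl p q r : qdot (p + q) r = qdot p r + qdot q r.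
Proof. by rewrite !qdotE !qcoefD; ring. Qed.

Lemma qdotDr p q r : qdot r (p + q) = qdot r p + qdot r q.
Proof. by rewrite !qdotE !qcoefD; ring. Qed.

Lemma qdotNl p q : qdot (- p) q = - qdot p q.
Proof. by rewrite !qdotE !qcoefN; ring. Qed.

Lemma qdotNr p q : qdot p (- q) = - qdot p q.
Proof. by rewrite !qdotE !qcoefN; ring. Qed.

Lemma qdotBl p q r : qdot (p - q) r = qdot p r - qdot q r.
Proof. by rewrite qdotDl qdotNl. Qed.

Lemma qdotBr p q r : qdot r (p - q) = qdot r p - qdot r q.
Proof. by rewrite qdotDr qdotNr. Qed.

Lemma qdotZl (a : R) p q : qdot (a *: p) q = a * qdot p q.
Proof. by rewrite !qdotE !qcoefZ; ring. Qed.

Lemma qdotZr (a : R) p q : qdot p (a *: q) = a * qdot p q.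
Proof. by rewrite !qdotE !qcoefZ; ring. Qed.

Lemma qdot0l q : qdot 0 q = 0.
Proof. by rewrite !qdotE !qcoef0; ring. Qed.

Lemma qdot11 : qdot (1 : H) 1 = 1.
Proof. by qsimp; ring. Qed.

Lemma qdot_ge0 q : 0 <= qdot q q.
Proof. by rewrite qdotE !addr_ge0// -expr2 sqr_ge0. Qed.

Lemma qdot_eq0 q : (qdot q q == 0) = (q == 0).
Proof.
apply/eqP/eqP => [|->]; last exact: qdot0l.
rewrite qdotE -!expr2 => h.
have [h0 h1 h2 h3] : [/\ qcoef q 0 = 0, qcoef q 1 = 0, qcoef q 2 = 0 & qcoef q 3 = 0].
  by split; apply/eqP; rewrite -sqrf_eq0 eq_le sqr_ge0 andbT; nra.
by apply: quatP => -[|[|[|[|//]]]] _; rewrite qcoef0.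
Qed.

Lemma qdot_gt0 q : (0 < qdot q q) = (q != 0).
Proof. by rewrite lt_neqAle qdot_ge0 andbT eq_sym qdot_eq0. Qed.

Lemma qdotM p q : qdot (p * q) (p * q) = qdot p p * qdot q q.
Proof. by do 3 qsimp; ring. Qed.

Lemma qdotMr p q r : qdot (p * r) (q * r) = qdot p q * qdot r r.
Proof. by do 3 qsimp; ring. Qed.

Lemma qdotMl p q r : qdot (r * p) (r * q) = qdot r r * qdot p q.
Proof. by do 3 qsimp; ring. Qed.

Lemma qmul_conj q : q * qconj q = (qdot q q)%:A.
Proof. by quat_eq; ring. Qed.

Lemma qconj_mul q : qconj q * q = (qdot q q)%:A.
Proof. by quat_eq; ring. Qed.

Definition qinv q : H := (qdot q q)^-1 *: qconj q.

Lemma qmulV q : q != 0 -> q * qinv q = 1.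
Proof.
rewrite -qdot_eq0 => q0; rewrite /qinv -scalerAr qmul_conj scalerA mulVf//.
by rewrite scale1r.
Qed.

Lemma qmulVl q : q != 0 -> qinv q * q = 1.
Proof.
rewrite -qdot_eq0 => q0; rewrite /qinv -scalerAl qconj_mul scalerA mulVf//.
by rewrite scale1r.
Qed.

Lemma qmul_eq0 p q : (p * q == 0) = (p == 0) || (q == 0).
Proof. by rewrite -!qdot_eq0 qdotM mulf_eq0. Qed.

Lemma qinv_neq0 q : q != 0 -> qinv q != 0.
Proof.
move=> /qmulV qV; apply/eqP => V0; move: qV; rewrite V0 mulr0 => /esym/eqP.
by rewrite oner_eq0.
Qed.

Lemma qmulK p q : q != 0 -> p * q * qinv q = p.
Proof. by move=> q0; rewrite -mulrA qmulV ?mulr1. Qed.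

Lemma qmulVK p q : q != 0 -> p * qinv q * q = p.
Proof. by move=> q0; rewrite -mulrA qmulVl ?mulr1. Qed.

(** If I^2 = -1 had a nonzero real part x, the imaginary coordinates y of I would
    vanish because 2 x y = 0, and I^2 would be a positive real. *)
Lemma imag_unitsP I : imag_units I <-> qcoef I 0 = 0 /\ qdot I I = 1.
Proof.
rewrite /imag_units/= expr2; split => [II|[I0 I1]].
  have e n : qcoef (I * I) n = qcoef (- 1 : H) n by rewrite II.
  have := e 0%N; have := e 1%N; have := e 2%N; have := e 3%N.
  rewrite !qcoefM ?qcoefN ?qcoef1 //= => e3 e2 e1 e0.
  have I0 : qcoef I 0 = 0.
    apply/eqP; rewrite -[_ == _]negbK; apply/negP => i0.
    have z (x : R) : qcoef I 0 * x + x * qcoef I 0 = 0 -> x = 0.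
      move=> h; apply: (mulfI i0); rewrite mulr0; lra.
    have h1 : qcoef I 1 = 0 by apply: z; lra.
    have h2 : qcoef I 2 = 0 by apply: z; lra.
    have h3 : qcoef I 3 = 0 by apply: z; lra.
    by have := sqr_ge0 (qcoef I 0); rewrite expr2; move: e0; rewrite h1 h2 h3; nra.
  by split => //; move: e0; rewrite qdotE I0; lra.
move: I1; rewrite qdotE I0 => I1; quat_eq; rewrite I0; lra.
Qed.

Lemma qdot_imag I p q : imag_units I -> qdot (I * p) q = - qdot p (I * q).
Proof. by move=> /imag_unitsP[I0 _]; do 3 qsimp; rewrite I0; ring. Qed.

Lemma imag_units_neq0 I : imag_units I -> I != 0.
Proof. by move=> /imag_unitsP[_ h]; rewrite -qdot_eq0 h oner_eq0. Qed.

Lemma exists_imag : exists I : H, imag_units I.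
Proof.
exists (mkquat 0 1 0 0); apply/imag_unitsP; split; first by rewrite qcoefE.
by qsimp; ring.
Qed.

(** Normalize the imaginary part of q; a real q lies on every slice. *)
Lemma slice_ptP q : exists2 I, imag_units I & exists z : R * R, q = slice_pt I z.
Proof.
pose v := q - (qcoef q 0)%:A.
have v0 : qcoef v 0 = 0 by rewrite /v; do 2 qsimp; ring.
have [vz|vn] := eqVneq v 0.
  have [I hI] := exists_imag; exists I => //; exists (qcoef q 0, 0).
  by rewrite /slice_pt/= scale0r addr0; apply/eqP; rewrite -subr_eq0; apply/eqP.
have n0 : 0 < qnorm v by rewrite sqrtr_gt0 qdot_gt0.
exists ((qnorm v)^-1 *: v).
  apply/imag_unitsP; split; first by rewrite qcoefZ v0 mulr0.
  rewrite qdotZl qdotZr mulrA -expr2 exprVn sqr_sqrtr ?qdot_ge0// mulVf//.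
  by rewrite qdot_eq0.
exists (qcoef q 0, qnorm v); rewrite /slice_pt/= scalerA mulfV ?gt_eqF// scale1r.
by rewrite addrC subrK.
Qed.

End QuaternionAlgebra.

(** Instance search does not see the neighbourhoods of a row vector behind those
    of a quaternion. *)
#[global] Instance quat_nbhs_filter (R : realType) (q : quat R) :
  ProperFilter (nbhs q) := nbhs_pfilter q.

(** * Lattices *)

Section Lattices.
Variable R : realType.
Local Notation H := (quat R).
Implicit Types (L : lattice R) (b : 4.-tuple H) (p q : H).

Lemma free_basis b : free b -> basis_of fullv b.
Proof. by move=> fb; rewrite basisEfree fb subvf dimvf size_tuple/=. Qed.

(** The coordinates in a real basis are linear forms, hence bounded by multiples
    of the sup norm.  This is what makes the lattice discrete. *)
Lemma coord_bound b : free b -> exists2 C : R, 0 < C &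
  forall (t : 'I_4 -> R) (m : R), 0 <= m ->
  (forall j, `|(\sum_i t i *: tnth b i) 0 j| <= m) -> forall i, `|t i| <= C * m.
Proof.
move=> fb.
pose C := 1 + \sum_i \sum_j `|coord b i (delta_mx 0 j : 'rV[R]_4)|.
exists C; first by rewrite ltr_pwDl// !sumr_ge0// => i _; rewrite sumr_ge0.
move=> t m m0 h i.
have -> : t i = coord b i (\sum_i t i *: tnth b i).
  rewrite (eq_bigr (fun i => t i *: b`_i)) ?coord_sum_free//.
  by move=> j _; rewrite (tnth_nth 0).
set v := \sum_i _ in h *.
rewrite {1}(row_sum_delta v : v = _) linear_sum/=.
apply: (le_trans (ler_norm_sum _ _ _)).
have hi : \sum_j `|coord b i (delta_mx 0 j : 'rV[R]_4)| <= C.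
  rewrite /C [in leRHS](bigD1 i)//= addrCA ler_wpDr// addr_ge0// sumr_ge0// => k _.
  by rewrite sumr_ge0.
apply: (@le_trans _ _ (\sum_j `|coord b i (delta_mx 0 j : 'rV[R]_4)| * m)).
  apply: ler_sum => j _; rewrite linearZ/= normrM mulrC.
  by rewrite ler_wpM2l.
by rewrite -mulr_suml ler_wpM2r.
Qed.

Lemma zspanE b (n : 'I_4 -> int) :
  \sum_i tnth b i *~ n i = \sum_i ((n i)%:~R : R) *: tnth b i.
Proof. by apply: eq_bigr => i _; rewrite scaler_int. Qed.

Lemma latticeN L p : lattice_set L p -> lattice_set L (- p).
Proof. by move=> Lp; rewrite -sub0r; apply: latticeB => //; exact: lattice0. Qed.

Lemma normr_quat_coord q j : `|q 0 j| <= `|q|.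
Proof.
rewrite [leRHS]/Num.Def.normr/= mx_normrE.
exact: (le_bigmax _ (fun i => `|q i.1 i.2|) (0, j)).
Qed.

(** The coordinates of a short lattice vector are integers of absolute value less
    than 1. *)
Lemma lattice_separated L : exists2 e : R, 0 < e &
  forall q, lattice_set L q -> `|q| < e -> q = 0.
Proof.
have [b [fb Lb]] := latticeP L; have [C C0 HC] := coord_bound fb.
exists C^-1; first by rewrite invr_gt0.
move=> q; rewrite Lb => -[n qE] qC.
have n0 i : n i = 0.
  have : `|(n i)%:~R : R| <= C * `|q|.
    apply: (HC (fun i => (n i)%:~R)) => // j.
    by rewrite -zspanE -qE normr_quat_coord.
  move/le_lt_trans => /(_ 1); rewrite -ltr_pdivlMl// mulr1 => /(_ qC).
  by rewrite -intr_norm (ltr_int _ _ 1); lia.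
by rewrite qE big1// => i _; rewrite n0 mulr0z.
Qed.

(** Only finitely many lattice vectors are as short as a given one, since their
    integer coordinates are bounded. *)
Lemma lattice_min L (P : set H) : (exists2 q, lattice_set L q & P q) ->
  exists q, [/\ lattice_set L q, P q &
    forall p, lattice_set L p -> P p -> qdot q q <= qdot p p].
Proof.
move=> [q0 Lq0 Pq0].
have [b [fb Lb]] := latticeP L; have [C C0 HC] := coord_bound fb.
(* x^2 <= d implies |x| <= d + 1 *)
pose B := qdot q0 q0 + 1.
have B0 : 0 <= B by rewrite addr_ge0// qdot_ge0.
have [N HN] : exists N : nat, C * B <= N%:R.
  by exists (Num.truncn (C * B)).+1; apply/ltW/truncnS_gt.
pose v (f : {ffun 'I_4 -> 'I_(N + N).+1}) : H :=
  \sum_i tnth b i *~ ((f i : nat)%:Z - N%:Z).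
have vL f : lattice_set L (v f) by rewrite Lb; exists (fun i => (f i : nat)%:Z - N%:Z).
have small p : lattice_set L p -> qdot p p <= qdot q0 q0 -> exists f, p = v f.
  rewrite Lb => -[n pE] pq.
  have nN i : `|n i| <= N%:Z.
    rewrite -(ler_int R) intr_norm; apply: le_trans HN.
    apply: (HC (fun i => (n i)%:~R)) => // j; rewrite -zspanE -pE.
    have pj : `|p 0 j| ^+ 2 <= qdot p p.
      rewrite /qdot (bigD1 j)//= real_normK ?num_real// expr2 ler_wpDr// sumr_ge0// => k _.
      by rewrite -expr2 sqr_ge0.
    by rewrite /B; nra.
  exists [ffun i => inord (absz (n i + N%:Z))]; rewrite pE; apply: eq_bigr => i _.
  congr (_ *~ _); rewrite ffunE inordK; have := nN i; lia.
have [f0 q0E] := small q0 Lq0 (lexx _).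
have Pf0 : `[< P (v f0) >] by apply/asboolP; rewrite -q0E.
have [f /asboolP Pf fmin] := @arg_minP _ _ _ f0 (fun f => `[< P (v f) >])
  (fun f => qdot (v f) (v f)) Pf0.
exists (v f); split => // p Lp Pp.
have [pq|/ltW qp] := leP (qdot p p) (qdot q0 q0).
  have [g pg] := small p Lp pq.
  by rewrite pg; apply: fmin; apply/asboolP; rewrite -pg.
by apply: le_trans qp; rewrite q0E; exact: fmin.
Qed.

(** A lattice spans a real vector space of dimension 4. *)
Lemma lattice_not_plane L p q :
  exists2 l, lattice_set L l & forall a b : R, l <> a *: p + b *: q.
Proof.
have [b [fb Lb]] := latticeP L; apply: contrapT => /forall2NP h.
have : (fullv <= <<[:: p; q]>>)%VS.
  rewrite -(span_basis (free_basis fb)); apply/span_subvP => l lb.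
  have [Ll|/existsNP[a /existsNP[c /contrapT ->]]] := h l.
    exfalso; apply: Ll; rewrite Lb; have /tnthP[i ->] := lb.
    exists (fun j => (j == i)%:Z); rewrite (bigD1 i)//= eqxx big1 ?addr0// => j ji.
    by rewrite (negbTE ji) mulr0z.
  by rewrite memvD// memvZ// memv_span// !inE eqxx ?orbT.
move=> /dimvS; rewrite dimvf/= => h4.
by have := leq_trans h4 (dim_span _).
Qed.

(** K is a closed fundamental parallelotope: subtract the integer parts of the
    coordinates. *)
Lemma lattice_box L : exists2 K : set H, compact K &
  forall q, exists2 l, lattice_set L l & K (q - l).
Proof.
have [b [fb Lb]] := latticeP L.
pose F (t : 'rV[R]_4) : H := \sum_i t 0 i *: tnth b i.
exists (F @` [set t : 'rV[R]_4 | forall i, `[0, 1]%classic (t ord0 i)]).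
  apply: continuous_compact; last first.
    by apply: (@rV_compact R 4 (fun=> `[0, 1]%classic)) => _; exact: segment_compact.
  apply: continuous_subspaceT => t; apply: (cvg_big (op := +%R)) => [|i _]; first exact: add_continuous.
  have ct : (s : 'rV[R]_4) 0 i @[s --> t] --> t 0 i by exact: (@coord_continuous R 1 4 0 i t).
  exact: (cvgZ ct (cvg_cst (tnth b i))).
move=> q; pose x i := coord b i q.
have qE : q = \sum_i x i *: tnth b i.
  rewrite {1}(coord_basis (free_basis fb) (memvf q)).
  by apply: eq_bigr => i _; rewrite (tnth_nth 0).
exists (\sum_i tnth b i *~ Num.floor (x i)); first by rewrite Lb; exists (fun i => Num.floor (x i)).
exists (\row_i (x i - (Num.floor (x i))%:~R)).
  move=> i; rewrite /= in_itv/= mxE subr_ge0 floor_le lerBlDl/=.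
  by have := floorD1_gt (x i); rewrite intrD => /ltW.
rewrite zspanE {1}qE -sumrB; apply: eq_bigr => i _.
by rewrite mxE scalerBl.
Qed.

End Lattices.

(** * The Cauchy-Riemann condition on a slice *)

Section DerivativeLemmas.
Variable R : realType.
Local Notation H := (quat R).

(** What slice regularity of a function asks of its restriction G to the slice
    R + R I at the point z. *)
Definition cr_at (I : H) (G : R * R -> H) (z : R * R) : Prop :=
  [/\ derivable G z (1, 0) /\ derivable G z (0, 1),
      {for z, continuous ('D_(1, 0) G)} /\ {for z, continuous ('D_(0, 1) G)} &
      2^-1 *: ('D_(1, 0) G z + I * 'D_(0, 1) G z) = 0].

(** The difference quotient is constant. *)
Lemma is_derive_increment (V W : normedModType R) (G : V -> W) (z v : V) (w : W) :
  (forall h : R, G (h *: v + z) - G z = h *: w) -> is_derive z v G w.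
Proof.
move=> Gh; have c : h^-1 *: ((G \o shift z) (h *: v) - G z) @[h --> 0^'] --> w.
  apply: cvg_near_cst; near=> h.
  by rewrite /= Gh scalerA mulVf ?scale1r//; near: h; exact: nbhs_dnbhs_neq.
by split; [exact: cvgP c|exact: cvg_lim c].
Unshelve. all: by end_near. Qed.

Lemma near_eq_derive_continuous (V W : normedModType R) (G G' : V -> W) (z v : V) :
  (\forall w \near z, G w = G' w) -> {for z, continuous ('D_v G)} ->
  {for z, continuous ('D_v G')}.
Proof.
move=> GG'; have E : \forall w \near z, 'D_v G w = 'D_v G' w.
  by move: (near_join GG'); apply: filterS => w; exact: near_eq_derive.
move=> c; rewrite /prop_for /continuous_at -(nbhs_singleton E).
by apply: cvg_trans c; apply: near_eq_cvg; apply: filterS E => w ->.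
Qed.

(** The Cauchy-Riemann condition is local; this lets it pass from local
    expressions to a globally defined function. *)
Lemma cr_at_near I G G' z :
  (\forall w \near z, G w = G' w) -> cr_at I G z -> cr_at I G' z.
Proof.
move=> GG' [[d1 d2] [c1 c2] e]; split.
- by split; [exact: near_eq_derivable d1|exact: near_eq_derivable d2].
- by split; [exact: near_eq_derive_continuous c1|exact: near_eq_derive_continuous c2].
- by rewrite -!(near_eq_derive _ GG').
Qed.

Lemma slice_pt_continuous (I : H) : continuous (slice_pt I).
Proof.
move=> z; rewrite /slice_pt; apply: cvgD; apply: cvgZ.
- exact: cvg_fst.
- exact: cvg_cst.
- exact: cvg_snd.
- exact: cvg_cst.
Qed.

Lemma qmulr_continuous (c : H) : continuous (fun q : H => q * c).
Proof.
have -> : (fun q : H => q * c) =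
    (fun q : H => \sum_i q 0 i *: ((delta_mx 0 i : H) * c)).
  apply/funext => q; rewrite [in LHS](row_sum_delta q) mulr_suml.
  by apply: eq_bigr => i _; rewrite scalerAl.
move=> q; apply: (cvg_big (op := +%R)) => [|i _]; first exact: add_continuous.
have ct : (s : 'rV[R]_4) 0 i @[s --> q] --> q 0 i by exact: (@coord_continuous R 1 4 0 i q).
exact: (cvgZ ct (cvg_cst _)).
Qed.

Lemma shift_fst (z : R * R) (h : R) : h *: (1, 0) + z = (h + z.1, z.2).
Proof.
apply: injective_projections; first exact: (congr1 (+%R^~ z.1) (mulr1 h)).
by rewrite -[RHS]add0r; exact: (congr1 (+%R^~ z.2) (mulr0 h)).
Qed.

Lemma shift_snd (z : R * R) (h : R) : h *: (0, 1) + z = (z.1, h + z.2).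
Proof.
apply: injective_projections; last exact: (congr1 (+%R^~ z.2) (mulr1 h)).
by rewrite -[RHS]add0r; exact: (congr1 (+%R^~ z.1) (mulr0 h)).
Qed.

Lemma slice_pt1 I (z : R * R) (h : R) :
  slice_pt I (h *: (1, 0) + z) = h%:A + slice_pt I z.
Proof. by rewrite shift_fst /slice_pt/= scalerDl addrA. Qed.

Lemma slice_pt2 I (z : R * R) (h : R) :
  slice_pt I (h *: (0, 1) + z) = h *: I + slice_pt I z.
Proof. by rewrite shift_snd /slice_pt/= scalerDl addrCA. Qed.

Lemma continuous_eq_cst (T U : topologicalType) (f : T -> U) (a : U) (z : T) :
  f = cst a -> {for z, continuous f}.
Proof. by move=> ->; exact: cst_continuous. Qed.

Lemma cr_at_affine I (a c : H) z : imag_units I ->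
  cr_at I (fun w => slice_pt I w * a + c) z.
Proof.
move=> II; pose G : R * R -> H := fun w => slice_pt I w * a + c; rewrite -/G.
have d1 (w : R * R) : is_derive w (1, 0) G a.
  apply: is_derive_increment => h.
  by rewrite /G slice_pt1 mulrDl -scalerAl mul1r -[_ + _ + c]addrA addrK.
have d2 (w : R * R) : is_derive w (0, 1) G (I * a).
  apply: is_derive_increment => h.
  by rewrite /G slice_pt2 mulrDl -scalerAl -[_ + _ + c]addrA addrK.
have e1 : 'D_(1, 0) G = cst a.
  by apply/funext => w; case: (d1 w).
have e2 : 'D_(0, 1) G = cst (I * a).
  by apply/funext => w; case: (d2 w).
split.
- by split; [case: (d1 z)|case: (d2 z)].
- split; [exact: (continuous_eq_cst e1)|exact: (continuous_eq_cst e2)].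
- have [_ v1] := d1 z; have [_ v2] := d2 z.
  rewrite (congr2 (fun x y => 2^-1 *: (x + I * y)) v1 v2).
  by rewrite mulrA -expr2 II mulN1r subrr scaler0.
Qed.

Lemma is_derive_line (V W : normedModType R) (G : V -> W) (z v : V) (w : W) (s : R) :
  is_derive (s *: v + z) v G w -> is_derive s (1 : R) (fun t => G (t *: v + z)) w.
Proof.
have E : (fun h : R => h^-1 *: ((G \o shift (s *: v + z)) (h *: v) - G (s *: v + z))) =
  (fun h : R => h^-1 *: (((fun t => G (t *: v + z)) \o shift s) (h *: 1) - G (s *: v + z))).
  apply/funext => h /=; congr (_ *: (G _ - _)).
  by rewrite [h *: 1]mulr1 scalerDl addrA.
move=> [d e]; split; first by move: d; rewrite /derivable E.
by move: e; rewrite /derive E.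
Qed.

(** The derivative only depends on the germ k of the increments: two functions
    with the same small increments have equal derivatives. *)
Lemma derive_lim (V W : normedModType R) (G : V -> W) (z v : V) (k : R -> W) :
  derivable G z v -> (\forall h \near (0 : R), G (h *: v + z) - G z = k h) ->
  'D_v G z = lim (h^-1 *: k h @[h --> 0^']).
Proof.
move=> dG Gk; rewrite /derive; congr (lim _).
have E : \forall h \near (0 : R)^',
    h^-1 *: ((G \o shift z) (h *: v) - G z) = h^-1 *: k h.
  by apply: nbhs_dnbhs; apply: filterS Gk => h /= ->.
have E' : \forall h \near (0 : R)^',
    h^-1 *: k h = h^-1 *: ((G \o shift z) (h *: v) - G z).
  by apply: filterS E => h ->.
by apply/seteqP; split; apply: near_eq_cvg; [exact: E|exact: E'].
Qed.

Lemma derive_shiftE (V W : normedModType R) (G : V -> W) (a z v : V) :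
  (fun h : R => h^-1 *: (((fun w => G (a + w)) \o shift z) (h *: v) - G (a + z))) =
  (fun h : R => h^-1 *: ((G \o shift (a + z)) (h *: v) - G (a + z))).
Proof. by apply/funext => h /=; rewrite addrCA. Qed.

Lemma derive_comp_shift (V W : normedModType R) (G : V -> W) (a z v : V) :
  'D_v (fun w => G (a + w)) z = 'D_v G (a + z).
Proof. by rewrite /derive derive_shiftE. Qed.

Lemma derivable_comp_shift (V W : normedModType R) (G : V -> W) (a z v : V) :
  derivable G (a + z) v -> derivable (fun w => G (a + w)) z v.
Proof. by rewrite /derivable derive_shiftE. Qed.

Lemma continuous_derive_shift (V W : normedModType R) (G : V -> W) (a z v : V) :
  {for a + z, continuous ('D_v G)} ->
  {for z, continuous ('D_v (fun w => G (a + w)))}.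
Proof.
move=> c; have -> : 'D_v (fun w => G (a + w)) = 'D_v G \o (fun w => a + w).
  by apply/funext => w; exact: derive_comp_shift.
apply: continuous_comp; last exact: c.
by apply: cvgD; [exact: cvg_cst|exact: cvg_id].
Qed.

Lemma continuous_deriveB (V W : normedModType R) (G G' : V -> W) (z v : V) :
  (\forall w \near z, derivable G w v /\ derivable G' w v) ->
  {for z, continuous ('D_v G)} -> {for z, continuous ('D_v G')} ->
  {for z, continuous ('D_v (G - G'))}.
Proof.
move=> d c c'.
have E : \forall w \near z, 'D_v G w - 'D_v G' w = 'D_v (G - G') w.
  by apply: filterS d => w [d1 d2]; rewrite deriveB.
rewrite /prop_for /continuous_at -(nbhs_singleton E).
apply: cvg_trans (cvgB c c'); apply: near_eq_cvg.
by apply: filterS E => w.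
Qed.

Lemma cr_at_shift (I : H) (G : R * R -> H) (a z : R * R) :
  cr_at I G (a + z) -> cr_at I (fun w => G (a + w)) z.
Proof.
move=> [[d1 d2] [c1 c2] e]; split.
- by split; [exact: (derivable_comp_shift d1)|exact: (derivable_comp_shift d2)].
- by split; [exact: (continuous_derive_shift c1)|exact: (continuous_derive_shift c2)].
- by rewrite !(derive_comp_shift G).
Qed.

(** The assumptions hold near z, not only at z, because continuity at z of the
    derivative of a difference needs both derivatives to exist around z. *)
Lemma cr_at_sub (I : H) (G G' : R * R -> H) (z : R * R) :
  (\forall w \near z, cr_at I G w) -> (\forall w \near z, cr_at I G' w) ->
  cr_at I (G - G') z.
Proof.
move=> n n'.
have [[d1 d2] [c1 c2] e] := nbhs_singleton n.
have [[d1' d2'] [c1' c2'] e'] := nbhs_singleton n'.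
split.
- by split; exact: derivableB.
- split.
    apply: (continuous_deriveB _ c1 c1'); apply: filterS2 n n' => w.
    by move=> [[? _] _ _] [[? _] _ _].
  apply: (continuous_deriveB _ c2 c2'); apply: filterS2 n n' => w.
  by move=> [[_ ?] _ _] [[_ ?] _ _].
- by rewrite (deriveB d1 d1') (deriveB d2 d2') mulrBr addrACA -opprD scalerBr e e' subr0.
Qed.

End DerivativeLemmas.

(** * Tori and their charts *)

Section Tori.
Local Open Scope quotient_scope.
Variable R : realType.
Local Notation H := (quat R).
Implicit Types (L : lattice R).

Lemma tproj_eq L p q : tproj L p = tproj L q <-> lattice_set L (p - q).
Proof. by split => [/eqquotP/asboolP|h]; [|apply/eqquotP/asboolP]. Qed.

Lemma tproj_surj L (t : torus L) : exists q, t = tproj L q.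
Proof. by exists (repr t); rewrite /tproj reprK. Qed.

Lemma tproj_continuous L : continuous (tproj L).
Proof. exact: pi_continuous. Qed.

(** The set of points congruent to a point of V is a union of translates of V. *)
Lemma tproj_open L (V : set H) : open V -> open (tproj L @` V).
Proof.
move=> oV; rewrite /open/= /quotient_open.
have -> : \pi_(torus L) @^-1` (tproj L @` V) =
    \bigcup_(l in lattice_set L) ((fun q => q + l) @^-1` V).
  apply/seteqP; split => [q [p Vp /tproj_eq pq]|q [l Ll Vql]] /=.
    by exists (p - q) => //=; rewrite addrC subrK.
  exists (q + l) => //; apply/tproj_eq.
  by rewrite addrAC subrr add0r.
apply: bigcup_open => l _.
have cl : continuous (fun q : H => q + l).
  by move=> q; apply: cvgD; [exact: cvg_id|exact: cvg_cst].
exact: (continuousP _).1 cl _ oV.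
Qed.

(** A ball is star-shaped around its centre. *)
Lemma connected_ball (p : H) (r : R) : connected (ball p r).
Proof.
have [r0|r0] := leP r 0.
  rewrite (_ : ball p r = set0); first exact: connected0.
  apply/seteqP; split => // q; rewrite -ball_normE/= => pq.
  by have := le_lt_trans (normr_ge0 _) pq; rewrite ltNge r0.
rewrite (_ : ball p r = \bigcup_(q in ball p r)
   ((fun t : R => p + t *: (q - p)) @` `[0, 1])).
  apply: bigcup_connected.
    exists p => q _; exists 0; last by rewrite scale0r addr0.
    by rewrite /= in_itv/= lexx ler01.
  move=> q _; apply: connected_continuous_connected; first exact: segment_connected.
  apply: continuous_subspaceT => t; apply: cvgD; first exact: cvg_cst.
  by apply: cvgZ; [exact: cvg_id|exact: cvg_cst].
apply/seteqP; split => [q pq|q [p' pp' [t]]].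
  exists q => //; exists 1; first by rewrite /= in_itv/= lexx ler01.
  by rewrite scale1r addrC subrK.
rewrite /= in_itv/= => /andP[t0 t1] <-; move: pp'; rewrite -ball_normE/=.
rewrite opprD addrA subrr add0r normrN normrZ ger0_norm// distrC.
by apply: le_lt_trans; rewrite ler_piMl.
Qed.

Lemma exists_chart L (V : set H) :
  (forall p q, V p -> V q -> lattice_set L (p - q) -> p = q) ->
  exists phi : torus L -> H, forall q, V q -> phi (tproj L q) = q.
Proof.
move=> inj.
have /choice[phi Hphi] : forall t : torus L, exists q,
    (exists2 p, V p & t = tproj L p) -> V q /\ t = tproj L q.
  move=> t; have [[p Vp tp]|h] := pselect (exists2 p, V p & t = tproj L p).
    by exists p.
  by exists 0 => /h.
exists phi => q Vq; have [|Vp /esym/tproj_eq pq] := Hphi (tproj L q); first by exists q.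
exact: inj pq.
Qed.

(** A ball whose radius is half the separation of L contains no two congruent
    points. *)
Lemma chart_at L (p : H) : exists V phi, @is_chart R L V phi /\ V p.
Proof.
have [e e0 He] := lattice_separated L.
have [|phi Hphi] := @exists_chart L (ball p (e / 2)).
  move=> q r; rewrite -ball_normE/= => pq pr Lqr.
  apply/eqP; rewrite -subr_eq0; apply/eqP/He => //.
  rewrite (splitr e) -(subrKA p); apply: le_lt_trans (ler_normD _ _) _.
  by rewrite (distrC q p) ltrD.
exists (ball p (e / 2)), phi; split; last by apply: ballxx; rewrite divr_gt0.
split => //; [exact: ball_open|exact: connected_ball].
Qed.

(** In charts around q0 and around its image, F reads as a function g, which is
    a lift of F near q0. *)
Lemma local_lift L1 L2 (F : torus L1 -> torus L2) (q0 : H) :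
  torus_regular F -> exists (U : set H) (g : H -> H),
  [/\ open U, U q0, forall q, U q -> F (tproj L1 q) = tproj L2 (g q),
      forall q, U q -> {for q, continuous g} &
      forall I z, imag_units I -> U (slice_pt I z) -> cr_at I (g \o slice_pt I) z].
Proof.
move=> [cF rF].
have [p0 Fp0] := tproj_surj (F (tproj L1 q0)).
have [V1 [phi1 [ch1 V1q]]] := chart_at L1 q0.
have [V2 [phi2 [ch2 V2p]]] := chart_at L2 p0.
have [oV1 _ E1] := ch1; have [oV2 _ E2] := ch2.
have cFp : continuous (F \o tproj L1).
  by move=> q; apply: continuous_comp; [exact: tproj_continuous|exact: cF].
have oF (W : set H) : open W -> open ((F \o tproj L1) @^-1` (tproj L2 @` W)).
  by move=> oW; apply: (continuousP _).1 cFp _ _; exact: tproj_open.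
exists [set q | V1 q /\ (tproj L2 @` V2) (F (tproj L1 q))], (phi2 \o F \o tproj L1).
split.
- by apply: openI => //; exact: oF.
- by split => //; exists p0.
- by move=> q [_ [p V2p' pF]]; rewrite /= -pF E2.
- move=> q [_ [p V2p' pF]] W; rewrite /= -pF E2// nbhsE => -[B [oB Bp] BW].
  rewrite nbhs_simpl/= nbhsE.
  exists ((F \o tproj L1) @^-1` (tproj L2 @` (B `&` V2))).
    by split; [apply: oF; exact: openI|exists p].
  by move=> q' [w [Bw Vw] /= wF]; rewrite /= -wF E2//; exact: BW.
- by move=> I z II Uz; exact: (rF V1 phi1 V2 phi2 ch1 ch2 I II z Uz).
Qed.

(** In charts, the map induced by q -> q a is locally q -> q a + l for a lattice
    vector l, which satisfies the Cauchy-Riemann equation on each slice because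
    I acts on the left and a on the right. *)
Lemma equivalent_of_scaling L1 L2 (a : H) : a != 0 ->
  (forall q, lattice_set L2 (q * a) <-> lattice_set L1 q) -> equivalent_tori L1 L2.
Proof.
have reg L L' (c : H) : (forall q, lattice_set L q -> lattice_set L' (q * c)) ->
    let F := (fun t : torus L => tproj L' (repr t * c)) in
    (forall q, F (tproj L q) = tproj L' (q * c)) /\ torus_regular F.
  move=> Lc F.
  have FE q : F (tproj L q) = tproj L' (q * c).
    apply/tproj_eq; rewrite -mulrBl; apply: Lc; apply/tproj_eq.
    by rewrite /tproj reprK.
  have cc : continuous (fun q : H => q * c).
    exact: qmulr_continuous.
  split => //; split.
    apply/quotient_continuous.
    rewrite (_ : F \o _ = tproj L' \o (fun q => q * c)); last exact/funext.
    by move=> q; apply: continuous_comp; [exact: cc|exact: tproj_continuous].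
  move=> V1 phi1 V2 phi2 ch1 [oV2 _ E2] I II fI z [V1z [p V2p pF]].
  pose l := p - slice_pt I z * c.
  have Ll : lattice_set L' l by apply/tproj_eq; rewrite pF FE.
  apply: (@cr_at_near _ I (fun w => slice_pt I w * c + l)); last exact: cr_at_affine.
  have c1 : continuous (fun w => slice_pt I w * c + l).
    move=> w; apply: cvgD; last exact: cvg_cst.
    by apply: (@continuous_comp _ _ _ (slice_pt I) (fun q => q * c)); 
      [exact: slice_pt_continuous|exact: cc].
  have : \forall w \near z, V2 (slice_pt I w * c + l).
    by apply: c1; apply: open_nbhs_nbhs; split => //; rewrite /l addrC subrK.
  apply: filterS => w V2w; rewrite /fI/= FE -[LHS]E2//; congr phi2.
  by apply/tproj_eq; rewrite addrAC subrr add0r.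
move=> a0 La.
have [FE rF] := reg L1 L2 a (fun q => (La q).2).
have La' q : lattice_set L2 q -> lattice_set L1 (q * qinv a).
  by move=> Lq; apply/La; rewrite qmulVK.
have [GE rG] := reg L2 L1 (qinv a) La'.
exists (fun t => tproj L2 (repr t * a)); split => //.
exists (fun t => tproj L1 (repr t * qinv a)); split => //.
- by move=> t; have [q ->] := tproj_surj t; rewrite FE GE qmulK.
- by move=> t; have [q ->] := tproj_surj t; rewrite GE FE qmulVK.
Qed.

End Tori.

(** * The maximum principle on slices *)

Section SliceMaximum.
Variable R : realType.
Local Notation H := (quat R).

Lemma qdot_continuous (m : H) : continuous (fun q : H => qdot q m).
Proof.
move=> q; apply: (cvg_big (op := +%R)) => [|i _]; first exact: add_continuous.
have ct : (s : 'rV[R]_4) 0 i @[s --> q] --> q 0 i by exact: (@coord_continuous R 1 4 0 i q).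
exact: (cvgM ct (cvg_cst (m 0 i))).
Qed.

Lemma is_derive_qdot (V : normedModType R) (G : V -> H) (z v : V) (w m : H) :
  is_derive z v G w -> is_derive z v (fun x => qdot (G x) m) (qdot w m).
Proof.
move=> [d e].
have c : h^-1 *: ((((fun x => qdot (G x) m) : V -> R) \o shift z) (h *: v) - qdot (G z) m)
    @[h --> 0^'] --> qdot w m.
  have -> : (fun h : R => h^-1 *: ((((fun x => qdot (G x) m) : V -> R) \o shift z) (h *: v) - qdot (G z) m))
    = (fun q => qdot q m) \o (fun h : R => h^-1 *: ((G \o shift z) (h *: v) - G z)).
    by apply/funext => h /=; rewrite qdotZl qdotBl.
  apply: continuous_cvg; first exact: qdot_continuous.
  by rewrite -e; exact: d.
by split; [exact: cvgP c|exact: cvg_lim c].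
Qed.

Lemma cr_at_derive2 (I : H) (G : R * R -> H) z : imag_units I -> cr_at I G z ->
  'D_(0, 1) G z = I * 'D_(1, 0) G z.
Proof.
move=> II [_ _ /eqP]; rewrite scaler_eq0 invr_eq0 pnatr_eq0/= addr_eq0 => /eqP ->.
by rewrite mulrN mulrA -expr2 II mulN1r opprK.
Qed.

(** With m the value at the maximum, the scalar products of G with m and with I m
    are the real and imaginary part of a holomorphic function.  The first one is
    maximal at z, so it is constant on circles by max_circle; by the equality
    case of Cauchy-Schwarz, so is G. *)
Lemma slice_max_circle (I : H) (G : R * R -> H) (z : R * R) (r t : R) :
  imag_units I -> (forall w, cr_at I G w) ->
  (forall w, qdot (G w) (G w) <= qdot (G z) (G z)) ->
  0 < t < pi *+ 2 -> G (circle_pt z r t) = G z.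
Proof.
move=> II crG Gmax t2; pose m := G z.
have dx (w : R * R) : is_derive w (1, 0) G ('D_(1, 0) G w).
  by have [[? _] _ _] := crG w; split.
have dy (w : R * R) : is_derive w (0, 1) G ('D_(0, 1) G w).
  by have [[_ ?] _ _] := crG w; split.
have um : qdot (G (circle_pt z r t)) m = qdot (G z) m.
  apply: (max_circle (u := fun w => qdot (G w) m) (v := fun w => qdot (G w) (I * m))
    (ux := fun w => qdot ('D_(1, 0) G w) m) (uy := fun w => qdot ('D_(0, 1) G w) m)) => //.
  - by move=> w; exact: is_derive_qdot.
  - by move=> w; exact: is_derive_qdot.
  - move=> w; rewrite (cr_at_derive2 II (crG w)) qdot_imag// opprK.
    exact: is_derive_qdot.
  - move=> w; rewrite (_ : qdot ('D_(1, 0) G w) m = qdot ('D_(0, 1) G w) (I * m)).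
      exact: is_derive_qdot.
    rewrite (cr_at_derive2 II (crG w)) qdotMl.
    by have [_ ->] := (imag_unitsP I).1 II; rewrite mul1r.
  - move=> w; apply: (@continuous_comp _ _ _ ('D_(1, 0) G) (fun q => qdot q m)).
      by have [_ [? _] _] := crG w.
    exact: qdot_continuous.
  - move=> w; apply: (@continuous_comp _ _ _ ('D_(0, 1) G) (fun q => qdot q m)).
      by have [_ [_ ?] _] := crG w.
    exact: qdot_continuous.
  - move=> w; have := qdot_ge0 (G w - m); have := Gmax w.
    rewrite -/m qdotBl !qdotBr (qdotC m); lra.
apply/eqP; rewrite -subr_eq0 -qdot_eq0 eq_le qdot_ge0 andbT -/m.
rewrite qdotBl !qdotBr (qdotC m) um -/m; rewrite subrr subr0 subr_le0; exact: Gmax.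
Qed.

(** Move from z vertically and then horizontally, along radii of two circles;
    the corner is again a maximum. *)
Lemma slice_max_const (I : H) (G : R * R -> H) (z w : R * R) :
  imag_units I -> (forall w, cr_at I G w) ->
  (forall w, qdot (G w) (G w) <= qdot (G z) (G z)) -> G w = G z.
Proof.
move=> II crG Gmax.
(* the angles pi / 2 and pi *)
have pi_itv (p : R) : 0 < p -> 0 < p / 2 < p *+ 2 /\ 0 < p < p *+ 2.
  by move=> p0; rewrite [p *+ 2]mulr2n; split; apply/andP; split; lra.
have [pi2 pi1] := pi_itv _ (pi_gt0 R).
have e1 : G (z.1, w.2) = G z.
  rewrite -(slice_max_circle (w.2 - z.2) II crG Gmax pi2) /circle_pt cos_pihalf sin_pihalf.
  by rewrite mulr0 addr0 mulr1 addrC subrK.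
rewrite -e1 -[in RHS](slice_max_circle (z := (z.1, w.2)) (z.1 - w.1) II crG _ pi1).
  rewrite /circle_pt/= cospi sinpi mulr0 addr0 mulrN1 opprB addrC subrK.
  by case: w {e1}.
by rewrite e1.
Qed.

(** The maximum propagates over one slice to the real axis, and from there to
    all slices. *)
Lemma max_const (D : H -> H) (q0 : H) :
  (forall I z, imag_units I -> cr_at I (D \o slice_pt I) z) ->
  (forall q, qdot (D q) (D q) <= qdot (D q0) (D q0)) -> forall q, D q = D q0.
Proof.
move=> crD Dmax.
have s0 (I : H) : slice_pt I (0, 0) = 0 by rewrite /slice_pt/= !scale0r addr0.
have D0 : D 0 = D q0.
  have [I II [z zE]] := slice_ptP q0.
  rewrite -(s0 I) zE; apply: (slice_max_const (G := D \o slice_pt I) _ II) => w.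
    exact: crD.
  by rewrite /= -zE.
move=> q; have [I II [z ->]] := slice_ptP q.
rewrite -D0 -(s0 I); apply: (slice_max_const (G := D \o slice_pt I) _ II) => w.
  exact: crD.
by rewrite /= s0 D0.
Qed.

End SliceMaximum.

(** * Regular maps between tori are affine *)

Section RegularMaps.
Variable R : realType.
Local Notation H := (quat R).

Variables (L1 L2 : lattice R) (F : torus L1 -> torus L2).

(** The function g represents F on the open set U: unlike a chart expression, it
    need not take values in a small set. *)
Definition lift_on (U : set H) (g : H -> H) : Prop :=
  [/\ open U, forall q, U q -> F (tproj L1 q) = tproj L2 (g q),
      forall q, U q -> {for q, continuous g} &
      forall I z, imag_units I -> U (slice_pt I z) -> cr_at I (g \o slice_pt I) z].

Lemma open_near (U : set H) q : open U -> U q -> \forall p \near q, U p.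
Proof. by move=> oU Uq; exact: open_nbhs_nbhs. Qed.

Lemma near_slice (U : set H) (I : H) (z : R * R) : open U -> U (slice_pt I z) ->
  \forall w \near z, U (slice_pt I w).
Proof. by move=> oU Uz; apply: slice_pt_continuous; exact: open_near. Qed.

Hypothesis rF : torus_regular F.

Lemma lift_at q : exists U g, lift_on U g /\ U q.
Proof. by have [U [g [oU Uq gF gc gcr]]] := local_lift q rF; exists U, g. Qed.

(** The difference of the displacements is a lattice vector too short to be
    nonzero. *)
Lemma lift_unique (e : R) p p' c c' :
  (forall q, lattice_set L2 q -> `|q| < e -> q = 0) ->
  tproj L2 p = tproj L2 p' -> tproj L2 (p + c) = tproj L2 (p' + c') ->
  `|c - c'| < e -> c = c'.
Proof.
move=> He /tproj_eq pp' /tproj_eq pcp'c' cc'; apply/eqP; rewrite -subr_eq0; apply/eqP.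
apply: He cc'; rewrite (_ : c - c' = (p + c - (p' + c')) - (p - p')).
  exact: latticeB.
by rewrite [- (p' + c')]opprD [p + c + _]addrACA [RHS]addrC addKr.
Qed.

Lemma tprojD p p' c : tproj L2 p = tproj L2 p' -> tproj L2 (p + c) = tproj L2 (p' + c).
Proof.
move=> /tproj_eq pp'; apply/tproj_eq.
by rewrite opprD addrACA subrr addr0.
Qed.

(** F is uniformly continuous, by compactness of the torus: a small real
    translation of the argument displaces the value by a small vector. *)
Lemma small_shift (e : R) : 0 < e -> exists2 d : R, 0 < d &
  forall h : R, `|h| < d -> forall q, exists2 c, `|c| < e &
  forall p, F (tproj L1 q) = tproj L2 p -> F (tproj L1 (h%:A + q)) = tproj L2 (p + c).
Proof.
move=> e0; have [K cK HK] := lattice_box L1.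
pose P (h : R) (q : H) := exists2 c, `|c| < e &
  forall p, F (tproj L1 q) = tproj L2 p -> F (tproj L1 (h%:A + q)) = tproj L2 (p + c).
have cA : continuous (fun h : R => h%:A : H).
  by move=> h; apply: cvgZ; [exact: cvg_id|exact: cvg_cst].
have : \forall h \near (0 : R), K `<=` P h.
  apply: ((compact_near_coveringP K).1 cK R (nbhs 0) P _) => q Kq.
  have [U [g [[oU gF gc _] Uq]]] := lift_at q.
  have e2 : 0 < e / 2 by rewrite divr_gt0.
  have /nbhs_ballP[r /= r0 Hr] : \forall w \near q, U w /\ `|g q - g w| < e / 2.
    apply: filterI; first exact: open_near.
    exact: ((cvgrPdist_lt _ _).1 (gc q Uq) (e / 2) e2).
  have r2 : 0 < r / 2 by rewrite divr_gt0.
  exists (ball q (r / 2), [set h : R | `|h%:A : H| < r / 2]) => [|[q' h] [/= qq' hr]].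
  split => /=.
  - exact: nbhsx_ballx.
  - apply: filterS ((cvgrPdist_lt _ _).1 (cA 0) (r / 2) r2) => h.
    by rewrite scale0r sub0r normrN.
  - have [Uq' gq'] : U q' /\ `|g q - g q'| < e / 2.
      by apply: Hr; apply: le_ball qq'; rewrite ler_pdivrMr// ler_peMr ?ler1n// ltW.
    have [Uhq' ghq'] : U (h%:A + q') /\ `|g q - g (h%:A + q')| < e / 2.
      apply: Hr; move: qq'; rewrite -!ball_normE/= => qq'.
      have -> : q - (h%:A + q') = (q - q') - h%:A by rewrite opprD addrCA addrC.
      rewrite (splitr r); apply: le_lt_trans (ler_normD _ _) _.
      by rewrite normrN ltrD.
    exists (g (h%:A + q') - g q').
      rewrite (splitr e) -(subrKA (g q)); apply: le_lt_trans (ler_normD _ _) _.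
      by rewrite ltrD// distrC.
    move=> p; rewrite !gF// => pg; rewrite -(tprojD _ pg).
    by rewrite addrCA subrr addr0.
move=> /nbhs_ballP[d /= d0 Hd]; exists d => // h hd q.
have [l Ll Kql] := HK q.
have [|c ce Hc] := Hd h _ (q - l) Kql; first by rewrite /ball/= sub0r normrN.
exists c => // p pq.
have ql : tproj L1 (q - l) = tproj L1 q.
  by apply/tproj_eq; rewrite addrAC subrr add0r; exact: latticeN.
rewrite -(Hc p); last by rewrite ql.
congr F; apply/tproj_eq; rewrite opprD addrACA subrr add0r opprB addrC subrK.
exact: Ll.
Qed.

(** The heart of the rigidity of regular maps.  The displacement D of the value of
    F under a translation by h is locally a difference of two lifts, so it is
    continuous and satisfies the Cauchy-Riemann equation on each slice, which
    real translations preserve.  It is periodic, so max_const applies. *)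
Lemma real_shift_const : exists (e d : R) (c : R -> H),
  [/\ 0 < e, 0 < d,
      forall q, lattice_set L2 q -> `|q| < e *+ 4 -> q = 0 &
      forall h, `|h| < d -> `|c h| < e /\
        forall q p, F (tproj L1 q) = tproj L2 p ->
          F (tproj L1 (h%:A + q)) = tproj L2 (p + c h)].
Proof.
have [e' e'0 He'] := lattice_separated L2.
(* the displacements compared below differ by less than 4 e *)
pose e := e' / 4.
have e0 : 0 < e by rewrite divr_gt0.
have e4 : e *+ 4 = e' by rewrite -mulr_natr divfK.
have He q : lattice_set L2 q -> `|q| < e *+ 4 -> q = 0 by rewrite e4; exact: He'.
have [d d0 Hd] := small_shift e0.
suff Hc h : exists c, `|h| < d -> `|c| < e /\ forall q p,
    F (tproj L1 q) = tproj L2 p -> F (tproj L1 (h%:A + q)) = tproj L2 (p + c).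
  by have [c {}Hc] := choice Hc; exists e, d, c.
have [hd|hd] := boolP (`|h| < d); last by exists 0.
have /choice[D HD] : forall q, exists c, `|c| < e /\ forall p,
    F (tproj L1 q) = tproj L2 p -> F (tproj L1 (h%:A + q)) = tproj L2 (p + c).
  by move=> q; have [c c1 c2] := Hd h hd q; exists c.
(* near q1 the displacement D is a difference of two local lifts of F, up to
   a lattice vector l that is locally constant because D stays small *)
have Dloc q1 : exists U1 g1 U2 g2 l, [/\ lift_on U1 g1, lift_on U2 g2, U1 q1,
    U2 (h%:A + q1) & \forall q \near q1, g2 (h%:A + q) - g1 q - l = D q].
  have [U1 [g1 [lift1 U1q]]] := lift_at q1.
  have [U2 [g2 [lift2 U2q]]] := lift_at (h%:A + q1).
  pose l := g2 (h%:A + q1) - g1 q1 - D q1.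
  exists U1, g1, U2, g2, l; split => //.
  have [oU1 g1F g1c _] := lift1; have [oU2 g2F g2c _] := lift2.
  have ch : continuous (fun q : H => h%:A + q).
    by move=> q; apply: cvgD; [exact: cvg_cst|exact: cvg_id].
  have Ll : lattice_set L2 l.
    rewrite /l -addrA -opprD; apply/tproj_eq; rewrite -g2F//.
    by apply: (HD q1).2; exact: g1F.
  have cX : g2 (h%:A + q) - g1 q - l @[q --> q1] --> g2 (h%:A + q1) - g1 q1 - l.
    apply: cvgB; last exact: cvg_cst.
    apply: cvgB; last exact: g1c.
    exact: (cvg_comp _ _ (ch q1) (g2c _ U2q)).
  have nU2 : \forall q \near q1, U2 (h%:A + q) by apply: ch; exact: open_near.
  have Dq1 : g2 (h%:A + q1) - g1 q1 - l = D q1 by rewrite /l opprB addrC subrK.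
  have nX : \forall q \near q1, `|D q1 - (g2 (h%:A + q) - g1 q - l)| < e.
    by rewrite -Dq1; exact: ((cvgrPdist_lt _ _).1 cX e e0).
  have nU1 : \forall q \near q1, U1 q by exact: open_near.
  near=> q.
  have Xq : `|D q1 - (g2 (h%:A + q) - g1 q - l)| < e by near: q.
  have U1q' : U1 q by near: q.
  have U2q' : U2 (h%:A + q) by near: q.
  have e1 : tproj L2 (g2 (h%:A + q) - l) = tproj L2 (g1 q + D q).
    rewrite -((HD q).2 (g1 q)); last exact: g1F.
    by rewrite g2F//; apply/tproj_eq; rewrite addrAC subrr add0r; exact: latticeN.
  apply: (@lift_unique (e *+ 4) (g1 q) (g1 q)) => //.
    by rewrite -e1; congr tproj; rewrite addrA [g1 q + _]addrC subrK.
  set X := _ - l in Xq *.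
  have Dq := (HD q).1; have Dq1' := (HD q1).1.
  apply: le_lt_trans (ler_normB _ _) _.
  have := ler_normB (D q1) (D q1 - X); rewrite subKr -mulr_natr; lra.
have DL q l : lattice_set L1 l -> D (q + l) = D q.
  move=> Ll; have [p pF] := tproj_surj (F (tproj L1 q)).
  have ql : tproj L1 (q + l) = tproj L1 q by apply/tproj_eq; rewrite addrAC subrr add0r.
  have hql : tproj L1 (h%:A + (q + l)) = tproj L1 (h%:A + q).
    by apply/tproj_eq; rewrite opprD addrACA subrr add0r addrAC subrr add0r.
  apply: (@lift_unique (e *+ 4) p p) => //.
    by rewrite -(HD q).2// -(HD (q + l)).2 ?ql// hql.
  apply: le_lt_trans (ler_normB _ _) _.
  have := (HD q).1; have := (HD (q + l)).1; rewrite -mulr_natr; lra.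
have Dc : continuous D.
  move=> q1; have [U1 [g1 [U2 [g2 [l [[_ _ g1c _] [_ _ g2c _] U1q U2q nD]]]]]] := Dloc q1.
  rewrite /continuous_at -(nbhs_singleton nD).
  apply: (cvg_trans (near_eq_cvg nD)).
  apply: cvgB; last exact: cvg_cst.
  apply: cvgB; last exact: g1c.
  have ch : h%:A + q @[q --> q1] --> h%:A + q1.
    by apply: cvgD; [exact: cvg_cst|exact: cvg_id].
  exact: (cvg_comp _ _ ch (g2c _ U2q)).
have [q0 Dmax] : exists q0, forall q, qdot (D q) (D q) <= qdot (D q0) (D q0).
  have [K cK HK] := lattice_box L1.
  have K0 : K !=set0 by have [l _ Kl] := HK 0; exists (0 - l).
  have cN : {within K, continuous (fun q => qdot (D q) (D q))}.
    apply: continuous_subspaceT => q; apply: (cvg_big (op := +%R)) => [|i _].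
      exact: add_continuous.
    have ci := cvg_comp _ _ (Dc q) (@coord_continuous R 1 4 0 i (D q)).
    exact: (cvgM ci ci).
  have [q0 _ q0max] := compact_EVT_max K0 cK cN.
  exists q0 => q; have [l Ll Kql] := HK q.
  rewrite -(DL q (- l)); last exact: latticeN.
  by apply: q0max; rewrite inE.
have crD I z : imag_units I -> cr_at I (D \o slice_pt I) z.
  move=> II.
  have [U1 [g1 [U2 [g2 [l [[oU1 _ _ g1cr] [oU2 _ _ g2cr] U1q U2q nD]]]]]] :=
    Dloc (slice_pt I z).
  pose G2 : R * R -> H := fun w => (g2 \o slice_pt I) ((h, 0) + w).
  pose G1 : R * R -> H := g1 \o slice_pt I.
  pose G0 : R * R -> H := fun w => slice_pt I w * 0 + l.
  have hE w : slice_pt I ((h, 0) + w) = h%:A + slice_pt I w.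
    by rewrite /slice_pt/= add0r scalerDl addrA.
  have n1 : \forall w \near z, cr_at I G1 w.
    by apply: filterS (near_slice oU1 U1q) => w; exact: g1cr.
  have n2 : \forall w \near z, cr_at I G2 w.
    have ch : continuous (fun q : H => h%:A + q).
      by move=> q; apply: cvgD; [exact: cvg_cst|exact: cvg_id].
    have nU2 := (continuousP _).1 ch _ oU2.
    apply: filterS (near_slice nU2 U2q) => w U2w; apply: cr_at_shift.
    by apply: g2cr => //; rewrite hE.
  have n0 : \forall w \near z, cr_at I G0 w.
    by near=> w; exact: cr_at_affine.
  have n21 : \forall w \near z, cr_at I (G2 - G1) w.
    have m1 := near_join n1; have m2 := near_join n2.
    exact: (@filterS2 _ (nbhs z) (nbhs_filter z) _ _ _
      (fun w h2 h1 => cr_at_sub h2 h1) m2 m1).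
  apply: cr_at_near (cr_at_sub n21 n0).
  apply: (@filterS _ (nbhs z) (nbhs_filter z) _ _ _ (@slice_pt_continuous _ I z _ nD)).
  move=> w /= <-.
  have g0E : slice_pt I w * 0 + l = l by rewrite mulr0 add0r.
  exact: (congr2 (fun a b => g2 a - g1 (slice_pt I w) - b) (hE w) g0E).
exists (D q0) => _; split => [|q p pF]; first exact: (HD q0).1.
by rewrite -(max_const crD Dmax q); exact: (HD q).2.
Unshelve. all: by end_near. Qed.

(** Small increments of any lift along the real axis are the constants c h of
    real_shift_const, so the derivative is the same for all lifts at all points. *)
Lemma real_derivative : exists a : H, forall U g I z,
  lift_on U g -> imag_units I -> U (slice_pt I z) ->
  is_derive z (1, 0) (g \o slice_pt I) a /\
  is_derive z (0, 1) (g \o slice_pt I) (I * a).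
Proof.
have [e [d [c [e0 d0 He Hc]]]] := real_shift_const.
exists (lim (h^-1 *: c h @[h --> 0^'])) => U g I z [oU gF gc gcr] II Uz.
have crg := gcr I z II Uz.
have [[d1 d2] _ _] := crg.
suff D1 : 'D_(1, 0) (g \o slice_pt I) z = lim (h^-1 *: c h @[h --> 0^']).
  split; first by split.
  by rewrite -D1 -(cr_at_derive2 II crg); split.
apply: derive_lim => //.
pose s (h : R) := h%:A + slice_pt I z.
have sE h : slice_pt I (h *: (1, 0) + z) = s h by exact: slice_pt1.
have s0 : s 0 = slice_pt I z by rewrite /s scale0r add0r.
have cs : s h @[h --> (0 : R)] --> s 0.
  by apply: cvgD; [apply: cvgZ; [exact: cvg_id|exact: cvg_cst]|exact: cvg_cst].
have nU : \forall h \near (0 : R), U (s h).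
  by apply: cs; apply: open_near => //; rewrite s0.
have nh : \forall h \near (0 : R), `|h| < d.
  by apply/nbhs_ballP; exists d => //= h; rewrite /ball/= sub0r normrN.
have ng : \forall h \near (0 : R), `|g (slice_pt I z) - g (s h)| < e.
  have cg : g (s h) @[h --> (0 : R)] --> g (slice_pt I z).
    by apply: (cvg_comp _ _ cs); rewrite s0; exact: gc.
  exact: ((cvgrPdist_lt _ _).1 cg e e0).
near=> h.
have hd : `|h| < d by near: h.
have Uh : U (s h) by near: h.
have gh : `|g (slice_pt I z) - g (s h)| < e by near: h.
rewrite /= sE; have [ch cF] := Hc h hd.
apply: (@lift_unique (e *+ 4) (g (slice_pt I z)) (g (slice_pt I z))) => //.
  rewrite addrC subrK -gF// -(cF (slice_pt I z)) //; exact: gF.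
apply: le_lt_trans (ler_normB _ _) _; rewrite distrC -mulr_natr; lra.
Unshelve. all: by end_near. Qed.

(** On a line in a slice, local lifts are affine with slope w.  The parameters s
    at which the formula holds form an open and closed set, since near any
    parameter the formula holds everywhere or nowhere. *)
Lemma lift_along (I : H) (z e : R * R) (w : H) (p : H) :
  (forall U g z', lift_on U g -> U (slice_pt I z') ->
     is_derive z' e (g \o slice_pt I) w) ->
  F (tproj L1 (slice_pt I z)) = tproj L2 p ->
  forall s : R, F (tproj L1 (slice_pt I (s *: e + z))) = tproj L2 (p + s *: w).
Proof.
move=> dw p0.
pose q s := slice_pt I (s *: e + z).
pose A := [set s : R | F (tproj L1 (q s)) = tproj L2 (p + s *: w)].
have cq : continuous q.
  move=> s; have c1 : t *: e + z @[t --> s] --> s *: e + z.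
    by apply: cvgD; [apply: cvgZ; [exact: cvg_id|exact: cvg_cst]|exact: cvg_cst].
  exact: (cvg_comp _ _ c1 (@slice_pt_continuous _ I _)).
(* membership in A is locally constant *)
have locA s0 : \forall s \near s0, A s <-> A s0.
  have [U [g [lift Us0]]] := lift_at (q s0).
  have [oU gF gc gcr] := lift.
  have /nbhs_ballP[r /= r0 Hr] : \forall s \near s0, U (q s).
    by apply: cq; exact: open_near.
  apply/nbhs_ballP; exists r => //= s rs.
  have gE : g (q s) - s *: w = g (q s0) - s0 *: w.
    apply/eqP; rewrite -subr_eq0 -qdot_eq0; set m := _ - _.
    rewrite {1}/m qdotBl subr_eq0; apply/eqP.
    apply: (@derive_zero_const _ (fun t => qdot (g (q t) - t *: w) m) s0 s r).
      move=> t tr.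
      have Ut : U (q t) by apply: Hr; rewrite /ball/= distrC.
      have := is_derive_qdot m (is_derive_line (dw U g _ lift Ut)).
      move=> d1; have d2 := is_derive_affine 0 (qdot w m) t.
      have := is_deriveB d1 d2; rewrite subrr => d12.
      rewrite (_ : (fun t => _) = (fun t => qdot ((g \o slice_pt I) (t *: e + z)) m)
        - (fun t => 0 + t * qdot w m)) //.
      by apply/funext => x; rewrite qdotBl qdotZl -[x * _]add0r.
    by move: rs; rewrite /ball/= distrC.
  have AE t : U (q t) -> A t <-> lattice_set L2 (g (q t) - t *: w - p).
    move=> Ut; rewrite /A/= gF//; split => [/tproj_eq|h].
      by rewrite opprD addrA addrAC.
    by apply/tproj_eq; rewrite opprD addrA addrAC.
  by rewrite (AE s (Hr _ rs)) (AE s0 Us0) gE.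
have : A = setT.
  have cR : connected [set: R] by apply/connected_intervalP => x y _ _ t.
  have oA : open A.
    rewrite openE => s As; apply: filterS (locA s) => t; case=> _; exact.
  have oA' : open (~` A).
    rewrite openE => s As; apply: filterS (locA s) => t tA /tA; exact: As.
  apply: cR.
  - by exists 0; rewrite /A/= /q scale0r add0r scale0r addr0.
  - by exists A => //; rewrite setTI.
  - by exists A; [rewrite -[A]setCK; exact: open_closedC|rewrite setTI].
by move=> AT s; have : A s by rewrite AT.
Qed.

Lemma torus_regular_affine : exists a p : H,
  forall q, F (tproj L1 q) = tproj L2 (p + q * a).
Proof.
have [a Ha] := real_derivative.
have [p pF] := tproj_surj (F (tproj L1 0)).
exists a, p => q; have [I II [[x y] ->]] := slice_ptP q.
have z0 : slice_pt I (0, 0) = 0 by rewrite /slice_pt/= !scale0r addr0.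
have F0 : F (tproj L1 (slice_pt I (0, 0))) = tproj L2 p by rewrite z0.
have h1 := @lift_along I (0, 0) (1, 0) a p
  (fun U g z' l Uz => (Ha U g I z' l II Uz).1) F0 x.
have := @lift_along I _ (0, 1) (I * a) _
  (fun U g z' l Uz => (Ha U g I z' l II Uz).2) h1 y.
rewrite shift_snd shift_fst/= !addr0 => ->.
by rewrite /slice_pt/= mulrDl -!scalerAl mul1r addrA.
Qed.

End RegularMaps.

(** The affine lift p + q a maps L1 into L2 because F is well defined; injectivity
    of F gives the converse. *)
Lemma biregular_scaling (R : realType) (L1 L2 : lattice R) :
  equivalent_tori L1 L2 -> exists2 a : quat R, a != 0 &
  forall q, lattice_set L2 (q * a) <-> lattice_set L1 q.
Proof.
move=> [F [rF [G [FK _ _]]]].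
have [a [p Fp]] := torus_regular_affine rF.
have iff q : lattice_set L2 (q * a) <-> lattice_set L1 q.
  split=> [Lqa|Lq].
    have : F (tproj L1 q) = F (tproj L1 0).
      by rewrite !Fp; apply/tproj_eq; rewrite mul0r addr0 addrAC subrr add0r.
    by move/(can_inj FK)/tproj_eq; rewrite subr0.
  have : F (tproj L1 q) = F (tproj L1 0).
    by congr F; apply/tproj_eq; rewrite subr0.
  by rewrite !Fp => /tproj_eq; rewrite mul0r addr0 addrAC subrr add0r.
exists a => //; apply/eqP => a0.
(* otherwise every quaternion, however small, would lie in L1 *)
have [e e0 He] := lattice_separated L1.
pose k := e / (1 + `|1 : quat R|).
have n0 : 0 < 1 + `|1 : quat R| by rewrite ltr_pwDl.
have k0 : 0 < k by rewrite divr_gt0.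
have /He : lattice_set L1 (k *: 1) by apply/iff; rewrite a0 mulr0; exact: lattice0.
rewrite normrZ gtr0_norm// /k mulrAC ltr_pdivrMr// ltr_pM2l// ltrDr ltr01.
move=> /(_ isT)/eqP; rewrite scaler_eq0 oner_eq0 orbF gt_eqF//.
Qed.

(** * Sixth roots of unity *)

Section SixthRoots.
Variable R : realType.
Local Notation H := (quat R).
Implicit Types (e q p : H) (x y : R).

(** Once products have been expanded, the identities below are linear in the
    remaining quaternions and can be checked on an arbitrary coordinate. *)
Local Ltac qlin :=
  apply: quatP => ? _; rewrite ?(qcoefD, qcoefN, qcoefZ); field.

(** The double angle formula and cos(pi - x) = - cos x give 2 c^2 + c - 1 = 0,
    whose only positive root is 1/2. *)
Lemma cos_pi3 : cos (pi / 3) = 2^-1 :> R.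
Proof.
have p0 := pi_gt0 R.
have c0 : 0 < cos (pi / 3 : R).
  by apply: cos_gt0_pihalf; apply/andP; split; lra.
have e2 : cos (pi / 3 *+ 2 : R) = - cos (pi / 3).
  have -> : pi / 3 *+ 2 = pi - pi / 3 :> R by rewrite mulr2n; lra.
  by rewrite cosB cospi sinpi mul0r addr0 mulN1r.
move: e2; rewrite cos_mulr2n; move: c0; set c := cos _ => c0 ce.
have : (c *+ 2 - 1) * (c + 1) = 0.
  rewrite (_ : _ * _ = c ^+ 2 *+ 2 - 1 + c); last by rewrite expr2 !mulr2n; ring.
  by rewrite ce addNr.
by move/eqP; rewrite mulf_eq0 => /orP[] /eqP; rewrite -?[c *+ 2]mulr_natr => h; lra.
Qed.

Lemma sin_pi3_sqr : sin (pi / 3) * sin (pi / 3) = 3 / 4 :> R.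
Proof. by have := cos2Dsin2 (pi / 3 : R); rewrite cos_pi3 !expr2; lra. Qed.

Lemma sin_pi3_gt0 : 0 < sin (pi / 3) :> R.
Proof. by apply: sin_gt0_pi; have p0 := pi_gt0 R; apply/andP; split; lra. Qed.

Lemma qexp_pi3 (I : H) : imag_units I ->
  qexp (pi / 3) I * qexp (pi / 3) I = qexp (pi / 3) I - 1.
Proof.
move=> II; have I2 : I * I = -1 by rewrite -expr2.
rewrite /qexp cos_pi3; set s := sin _.
rewrite mulrDl !mulrDr -!scalerAl -!scalerAr !mul1r !mulr1 I2 !scalerA sin_pi3_sqr.
by qlin.
Qed.

(** If e^2 = e - 1 then (2 e - 1)^2 = -3, so I is (2 e - 1) / sqrt 3. *)
Lemma sixth_root_qexp e : e * e = e - 1 ->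
  exists2 I, imag_units I & e = qexp (pi / 3) I.
Proof.
move=> e2; have s0 := sin_pi3_gt0; have s2 := sin_pi3_sqr.
pose s : R := sin (pi / 3); rewrite -/s in s0 s2.
exists (s^-1 *: (e - 2^-1 *: 1)); last first.
  by rewrite /qexp cos_pi3 scalerA mulfV ?gt_eqF// scale1r addrC subrK.
rewrite /imag_units/= expr2 -scalerAl -scalerAr scalerA.
rewrite mulrBl !mulrBr -!scalerAl -!scalerAr !mul1r mulr1 e2 !scalerA.
rewrite -invfM s2.
have -> : e - 1 - 2^-1 *: e - (2^-1 *: e - (2^-1 * 2^-1) *: 1) = (- (3 / 4)) *: (1 : H).
  by qlin.
by rewrite scalerA mulrN mulVf ?scaleN1r//; lra.
Qed.

Lemma sixth_root_coord e : e * e = e - 1 ->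
  [/\ qcoef e 0 = 2^-1, qdot e e = 1, qdot 1 e = 2^-1 & e != 0].
Proof.
move=> /sixth_root_qexp[I /imag_unitsP[I0 I1] eE].
have e0 : qcoef e 0 = 2^-1.
  by rewrite eE /qexp qcoefD !qcoefZ I0 mulr0 addr0 qcoef1//= mulr1 cos_pi3.
have e1 : qdot 1 e = 2^-1.
  by rewrite qdotE !qcoef1//= e0; lra.
have e2 : qdot e e = 1.
  rewrite {1}eE /qexp qdotDl !qdotZl e1 cos_pi3 eE /qexp qdotDr !qdotZr I1.
  have -> : qdot I 1 = 0 by rewrite qdotC qdotE !qcoef1//= I0; lra.
  by have := sin_pi3_sqr; lra.
by split => //; rewrite -qdot_eq0 e2 oner_eq0.
Qed.

(** The plane R + R e, in which the Eisenstein integers Z + Z e form a hexagonal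
    lattice when e is a primitive sixth root of unity. *)
Definition eis e x y : H := x *: 1 + y *: e.

Lemma eisD e x y x' y' : eis e x y + eis e x' y' = eis e (x + x') (y + y').
Proof. by rewrite /eis addrACA -!scalerDl. Qed.

Lemma eisN e x y : - eis e x y = eis e (- x) (- y).
Proof. by rewrite /eis opprD !scaleNr. Qed.

Lemma eisB e x y x' y' : eis e x y - eis e x' y' = eis e (x - x') (y - y').
Proof. by rewrite eisN eisD. Qed.

Lemma eisZ e a x y : a *: eis e x y = eis e (a * x) (a * y).
Proof. by rewrite /eis scalerDr !scalerA. Qed.

Lemma eis00 e : eis e 0 0 = 0.
Proof. by rewrite /eis !scale0r addr0. Qed.

Lemma eisM e x y x' y' : e * e = e - 1 ->
  eis e x y * eis e x' y' = eis e (x * x' - y * y') (x * y' + y * x' + y * y').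
Proof.
move=> e2; rewrite /eis mulrDl !mulrDr -!scalerAl -!scalerAr !mul1r mulr1 e2 !scalerA.
by qlin.
Qed.

Lemma eis_norm e x y : e * e = e - 1 ->
  qdot (eis e x y) (eis e x y) = x * x + x * y + y * y.
Proof.
move=> /sixth_root_coord[_ ee e1 _].
rewrite /eis qdotDl !qdotDr !qdotZl !qdotZr ee (qdotC e) e1 qdot11; lra.
Qed.

(** The second factor is the conjugate x + y (1 - e) of the first. *)
Lemma eis_inv e x y : e * e = e - 1 ->
  eis e x y * eis e (x + y) (- y) = (qdot (eis e x y) (eis e x y))%:A.
Proof.
move=> e2; rewrite eisM// eis_norm// /eis.
rewrite [X in _ + X](_ : _ = 0) ?addr0; last first.
  by rewrite [X in X *: _](_ : _ = 0) ?scale0r//; ring.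
by congr (_ *: _); ring.
Qed.

Lemma round_int x : exists n : int, `|x - n%:~R| <= 2^-1.
Proof.
exists (Num.floor (x + 2^-1)).
have := floor_le (x + 2^-1); have := floorD1_gt (x + 2^-1); rewrite intrD => h1 h2.
by rewrite ler_norml; apply/andP; split; lra.
Qed.

(** With N(s, t) = s^2 + s t + t^2 = (s + t / 2)^2 + 3 t^2 / 4, first round the
    second coordinate to make |t| at most 1/2, then the first one to make
    |s + t / 2| at most 1/2.  The optimal constant is 1/3; any constant below 1/2
    serves the reduction in module_eq_zspan. *)
Lemma eis_round e x y : e * e = e - 1 -> exists m n : int,
  qdot (eis e (x - m%:~R) (y - n%:~R)) (eis e (x - m%:~R) (y - n%:~R)) <= 7 / 16.
Proof.
move=> e2; have [n Hn] := round_int y.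
pose t := y - n%:~R; have [m Hm] := round_int (x + t / 2).
exists m, n; rewrite eis_norm// -/t; rewrite -/t in Hn.
have := Hm; set s := x - m%:~R.
rewrite (_ : x + t / 2 - m%:~R = s + t / 2); last by rewrite /s; ring.
move: Hn; rewrite !ler_norml => /andP[t1 t2] /andP[s1 s2]; nra.
Qed.

End SixthRoots.

(** * Lattices over the Eisenstein integers *)

Section SpecialBasis.
Variable R : realType.
Local Notation H := (quat R).
Implicit Types (e q p : H) (x y : R).

Local Notation basis4 e a := [tuple 1; e; a; a * e].

Lemma basis4_combE e a (c : 'I_4 -> R) :
  \sum_i c i *: tnth (basis4 e a) i =
  eis e (c ord0) (c (lift ord0 ord0)) +
    a * eis e (c (lift ord0 (lift ord0 ord0))) (c (lift ord0 (lift ord0 (lift ord0 ord0)))).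
Proof.
rewrite !big_ord_recl big_ord0 addr0 /eis mulrDr -!scalerAr mulr1 !addrA.
by [].
Qed.

Section Plane.
Variables (e a : H).
Hypothesis e2 : e * e = e - 1.
Hypothesis a_out : forall x y, a != eis e x y.

(** If x' + y' e is nonzero, multiplying by its conjugate writes a as an element
    of the plane. *)
Lemma eis_independent x y x' y' :
  eis e x y + a * eis e x' y' = 0 -> [/\ x = 0, y = 0, x' = 0 & y' = 0].
Proof.
have eq0 z w : eis e z w = 0 -> z = 0 /\ w = 0.
  move/eqP; rewrite -qdot_eq0 eis_norm// => /eqP h.
  by split; apply/eqP; rewrite -sqrf_eq0 eq_le sqr_ge0 andbT expr2; nra.
move=> h; have [w0|w0] := eqVneq (eis e x' y') 0.
  by move: h; rewrite w0 mulr0 addr0 => /eq0[-> ->]; have [-> ->] := eq0 _ _ w0.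
exfalso; move: w0; rewrite -qdot_eq0; set N := qdot _ _ => N0.
have aN : a * N%:A = - (eis e x y * eis e (x' + y') (- y')).
  rewrite /N -eis_inv// mulrA -mulNr; congr (_ * _).
  by apply/eqP; rewrite -addr_eq0 addrC h.
rewrite eisM// eisN in aN.
have := a_out (N^-1 * - (x * (x' + y') - y * - y'))
  (N^-1 * - (x * - y' + y * (x' + y') + y * - y')).
by rewrite -eisZ -aN -scalerAr mulr1 scalerA mulVf// scale1r eqxx.
Qed.

Lemma basis4_free : free (basis4 e a).
Proof.
apply/freeP => c; rewrite (eq_bigr (fun i => c i *: tnth (basis4 e a) i)); last first.
  by move=> i _; rewrite (tnth_nth 0).
rewrite basis4_combE => /eis_independent[c0 c1 c2 c3] i.
by case: (unliftP ord0 i) => [j|] ->//; case: (unliftP ord0 j) => [k|] ->//;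
  case: (unliftP ord0 k) => [l|] ->//; rewrite (ord1 l).
Qed.

Lemma basis4_span q : exists x y x' y', q = eis e x y + a * eis e x' y'.
Proof.
have := coord_basis (free_basis basis4_free) (memvf q).
rewrite (eq_bigr (fun i => coord (basis4 e a) i q *: tnth (basis4 e a) i)); last first.
  by move=> i _; rewrite (tnth_nth 0).
by rewrite basis4_combE => ->; do 4 eexists.
Qed.

(** Projecting a orthogonally to the plane R + R e suffices: right multiplication
    by elements of the plane is a similarity preserving the plane, so it
    preserves its orthogonal complement. *)
Lemma orthogonal_split : exists s t, let r := a - eis e s t in
  (forall x y x' y', qdot (eis e x y) (r * eis e x' y') = 0) /\
  qdot r r <= qdot a a.
Proof.
have [e0 ee e1 _] := sixth_root_coord e2.
(* the Gram matrix of 1 and e has diagonal 1 and off-diagonal 1/2 *)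
pose s := (4 / 3) * (qdot 1 a - qdot e a / 2).
pose t := (4 / 3) * (qdot e a - qdot 1 a / 2).
exists s, t => r.
have r1 : qdot 1 r = 0 by rewrite /r /eis qdotBr qdotDr !qdotZr qdot11 e1 /s /t; field.
have re : qdot e r = 0.
  by rewrite /r /eis qdotBr qdotDr !qdotZr (qdotC e 1) ee e1 /s /t; field.
have ere : qdot e (r * e) = 0 by rewrite -{1}[e]mul1r qdotMr r1 mul0r.
have r1e : qdot 1 (r * e) = 0.
  have : qdot (e * e) (r * e) = 0 by rewrite qdotMr re mul0r.
  by rewrite e2 qdotBl ere; lra.
have orth x y x' y' : qdot (eis e x y) (r * eis e x' y') = 0.
  rewrite /eis mulrDr -!scalerAr mulr1 qdotDl !qdotDr !qdotZl !qdotZr r1 re ere r1e; ring.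
split => //.
have aE : a = eis e s t + r by rewrite /r addrC subrK.
clearbody r.
have o1 : qdot (eis e s t) r = 0.
  by have := orth s t 1 0; rewrite {2}/eis scale1r scale0r addr0 mulr1.
move: (eis e s t) o1 aE => p o1 ->.
by rewrite qdotDl !qdotDr (qdotC r p) o1; have := qdot_ge0 p; lra.
Qed.

End Plane.

Definition int_eis e : set H := [set q | exists m n : int, q = eis e m%:~R n%:~R].

Lemma zspan4E e a q : zspan (basis4 e a) q <->
  exists m n m' n' : int, q = eis e m%:~R n%:~R + a * eis e m'%:~R n'%:~R.
Proof.
split=> [[n ->]|[m [n [m' [n' ->]]]]].
  by rewrite zspanE basis4_combE; do 4 eexists.
exists (fun i => [:: m; n; m'; n']`_i).
by rewrite zspanE basis4_combE.
Qed.

Variables (M : set H) (e a : H).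
Hypothesis e2 : e * e = e - 1.
Hypothesis M1 : M 1.
Hypothesis MB : forall p q, M p -> M q -> M (p - q).
Hypothesis Me : forall q, M q -> M (q * e).
Hypothesis M_min : forall q, M q -> q != 0 -> 1 <= qdot q q.
Hypothesis Ma : M a.
Hypothesis a_out : ~ int_eis e a.
Hypothesis a_min : forall q, M q -> ~ int_eis e q -> qdot a a <= qdot q q.

Lemma module0 : M 0. Proof. by rewrite -(subrr 1); exact: MB. Qed.

Lemma moduleN q : M q -> M (- q).
Proof. by move=> Mq; rewrite -sub0r; exact: MB module0 Mq. Qed.

Lemma moduleD p q : M p -> M q -> M (p + q).
Proof. by move=> Mp Mq; rewrite -[q]opprK; exact: MB (moduleN Mq). Qed.

Lemma moduleMz (n : int) q : M q -> M (n%:~R *: q).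
Proof.
move=> Mq; rewrite scaler_int.
have Hn (m : nat) : M (q *+ m).
  elim: m => [|m IH]; first by rewrite mulr0n; exact: module0.
  by rewrite mulrS; exact: moduleD.
case: n => m; first by rewrite -pmulrn.
by rewrite NegzE mulrNz -pmulrn; exact: moduleN.
Qed.

Lemma module_eis q (m n : int) : M q -> M (q * eis e m%:~R n%:~R).
Proof.
by move=> Mq; rewrite /eis mulrDr -!scalerAr mulr1; apply: moduleD; apply: moduleMz => //; exact: Me.
Qed.

Lemma int_eis_module (m n : int) : M (eis e m%:~R n%:~R).
Proof. by rewrite -[eis _ _ _]mul1r; exact: module_eis. Qed.

(** Rounding would give a nonzero vector of M of squared norm at most 7/16. *)
Lemma minimal_not_plane x y : a != eis e x y.
Proof.
apply/eqP => aE; have [m [n Hmn]] := eis_round x y e2.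
apply: a_out; exists m, n; apply/eqP; rewrite -subr_eq0; apply/negP => /negP h.
have := M_min (MB Ma (int_eis_module m n)) h; rewrite aE eisB; lra.
Qed.

Lemma minimal_norm : 1 <= qdot a a.
Proof.
apply: M_min => //; have := minimal_not_plane 0 0.
by rewrite eis00.
Qed.

(** Write a vector of M as x + a y with x, y in the plane, and a as s + r with s in
    the plane and r orthogonal to it.  Rounding y, and then x + s y, leaves
    p + r w with squared norm at most 7/16 (1 + |r|^2), which is below |a|^2 as
    |a| is at least 1; by minimality of a this remainder is in Z[e]. *)
Lemma module_eq_zspan : M = zspan (basis4 e a).
Proof.
apply/seteqP; split => q; last first.
  by move=> /zspan4E[m [n [m' [n' ->]]]]; apply: moduleD; [exact: int_eis_module|exact: module_eis].
move=> Mq; apply/zspan4E.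
have [x [y [x' [y' qE]]]] := basis4_span e2 minimal_not_plane q.
have [s [t [orth rle]]] := orthogonal_split a e2; set r := a - eis e s t in orth rle.
have [m' [n' Hy]] := eis_round x' y' e2.
set w := eis e _ _ in Hy.
have [c [d cd]] : exists c d, eis e x y + eis e s t * w = eis e c d.
  by rewrite /w eisM// eisD; do 2 eexists.
have [m [n Hc]] := eis_round c d e2.
pose q' := q - a * eis e m'%:~R n'%:~R - eis e m%:~R n%:~R.
have Mq' : M q' by apply: MB; [apply: MB => //; exact: module_eis|exact: int_eis_module].
have q'E : q' = eis e (c - m%:~R) (d - n%:~R) + r * w.
  have aw : a * w = a * eis e x' y' - a * eis e m'%:~R n'%:~R.
    by rewrite /w -eisB mulrBr.
  rewrite /q' qE -eisB -cd [r * w]mulrBl aw.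
  move: (a * _) (a * _) (eis e x y) (eis e s t * w) (eis e m%:~R n%:~R) => A B C D E.
  by apply: quatP => k _; rewrite !(qcoefD, qcoefN); ring.
have [[k [l q'k]]|q'out] := pselect (int_eis e q').
  exists (k + m), (l + n), m', n'; rewrite !intrD -eisD -q'k /q'.
  by rewrite subrK subrK.
have := orth (c - m%:~R) (d - n%:~R) (x' - m'%:~R) (y' - n'%:~R).
have := a_min Mq' q'out; rewrite q'E -/w.
move: (eis e (c - m%:~R) (d - n%:~R)) Hc => p Hc h o; exfalso.
have rw : qdot r r * qdot w w <= qdot a a * (7 / 16).
  by apply: ler_pM => //; exact: qdot_ge0.
move: h; rewrite qdotDl !qdotDr (qdotC (r * w)) o qdotM.
by have := minimal_norm; lra.
Qed.

(** What basis4_special extracts from the coprimality condition. *)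
Lemma gcd_neq0 (n : 'rV[int]_4) (k : 'I_4) :
  \big[gcdz/0]_(j < 4 | (k <= j)%N) n 0 j = 1 -> exists2 j : 'I_4, (k <= j)%N & n 0 j != 0.
Proof.
move=> g1; apply: contrapT => /forall2NP h.
suff : \big[gcdz/0]_(j < 4 | (k <= j)%N) n 0 j = 0 by rewrite g1.
elim/big_rec: _ => // j x kj ->.
by have [|/negP/negbNE/eqP ->] := h j.
Qed.

Lemma gram_form (b : 4.-tuple H) (n : 'rV[int]_4) :
  let nR : 'rV[R]_4 := map_mx intr n in
  (nR *m gram b *m nR^T) 0 0 =
    qdot (\sum_i (n 0 i)%:~R *: tnth b i) (\sum_i (n 0 i)%:~R *: tnth b i).
Proof.
move=> nR.
have suml (I : finType) (f : I -> H) p : qdot (\sum_i f i) p = \sum_i qdot (f i) p.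
  by elim/big_rec2: _ => [|i x y _ <-]; rewrite ?qdot0l// qdotDl.
have sumr (I : finType) (f : I -> H) p : qdot p (\sum_i f i) = \sum_i qdot p (f i).
  by rewrite qdotC suml; apply: eq_bigr => i _; rewrite qdotC.
rewrite sumr mxE; apply: eq_bigr => j _.
rewrite qdotZr !mxE mulrC suml; congr (_ * _); apply: eq_bigr => i _.
by rewrite !mxE qdotZl.
Qed.

Hypothesis a_sign : 0 <= qdot e a.

(** The two conditions on 1 and e say that 1 is a shortest vector of M; the two
    conditions on a and a e, of equal length, say that a is a shortest vector
    outside Z[e]. *)
Lemma basis4_special : special_basis (basis4 e a).
Proof.
have [e0 ee e1 _] := sixth_root_coord e2.
have fr := basis4_free e2 minimal_not_plane.
split => //; split.
  move=> i j; rewrite mxE.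
  case: (unliftP ord0 i) => [i1|] ->; last first.
    move=> j1; have -> : j = lift ord0 ord0 by apply: val_inj; rewrite [LHS]j1.
    by rewrite /= !(tnth_nth 0)/= e1 invr_ge0.
  case: (unliftP ord0 i1) => [i2|] ->; last first.
    move=> j1; have -> : j = lift ord0 (lift ord0 ord0) by apply: val_inj; rewrite [LHS]j1.
    by rewrite /= !(tnth_nth 0)/=.
  case: (unliftP ord0 i2) => [i3|] ->; last first.
    move=> j1; have -> : j = lift ord0 (lift ord0 (lift ord0 ord0)) by apply: val_inj; rewrite [LHS]j1.
    rewrite !(tnth_nth 0)/= -{1}[a]mulr1 qdotMl e1 mulr_ge0 ?qdot_ge0// invr_ge0//.
  by rewrite (ord1 i3) => j4; have := ltn_ord j; rewrite j4.
move=> k n /gcd_neq0[j kj nj]; cbv zeta; rewrite gram_form mxE.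
set q := \sum_i _.
have Mq : M q by rewrite module_eq_zspan; exists (fun i => n 0 i); rewrite zspanE.
have qE := basis4_combE e a (fun i => (n 0 i)%:~R : R); rewrite -/q in qE.
have indep := eis_independent e2 minimal_not_plane.
have nz i : (n 0 i)%:~R = 0 :> R -> n 0 i = 0 by move/eqP; rewrite intr_eq0 => /eqP.
have q0 : q != 0.
  apply/eqP => q0; move/eqP: nj; apply; apply: nz; move: qE; rewrite q0 => /esym/indep[? ? ? ?].
  by case: (unliftP ord0 j) => [j1|] ->//; case: (unliftP ord0 j1) => [j2|] ->//;
    case: (unliftP ord0 j2) => [j3|] ->//; rewrite (ord1 j3).
have q1 := M_min Mq q0.
have qa : (1 < j)%N -> qdot a a <= qdot q q.
  move=> j1; apply: a_min => // -[m [m' qm]]; move/eqP: nj; apply; apply: nz.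
  move: qE; rewrite qm => /eqP; rewrite -subr_eq0 opprD addrA eisB => /eqP.
  rewrite -mulrN eisN => /indep[_ _ /eqP + /eqP].
  rewrite !oppr_eq0 => /eqP ? /eqP ?; move: j1.
  by case: (unliftP ord0 j) => [j1|] ->//; case: (unliftP ord0 j1) => [j2|] ->//;
    case: (unliftP ord0 j2) => [j3|] ->//; rewrite (ord1 j3).
move: kj; case: (unliftP ord0 k) => [k1|] ->; last by rewrite (tnth_nth 0)/= qdot11.
case: (unliftP ord0 k1) => [k2|] ->; last by rewrite (tnth_nth 0)/= ee.
case: (unliftP ord0 k2) => [k3|] ->; last by rewrite (tnth_nth 0)/=; exact: qa.
rewrite (ord1 k3) (tnth_nth 0)/= qdotM ee mulr1 => j3; apply: qa.
by apply: leq_trans j3.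
Qed.

End SpecialBasis.

(** * Symmetries of order six *)

Section Symmetries.
Variable R : realType.
Local Notation H := (quat R).
Implicit Types (L : lattice R) (u I : H).

(** Right multiplication by the inverse of a shortest vector v normalizes L to a
    lattice M on which v u v^-1 acts.  The sign of the second minimal vector is
    free, which settles the one sign condition not automatic in a reduced basis. *)
Lemma modulus_of_symmetry L u : u * u = u - 1 ->
  (forall q, lattice_set L q -> lattice_set L (q * u)) ->
  exists I alpha, [/\ imag_units I, 1 <= qnorm alpha &
    is_modulus L (qexp (pi / 3) I, alpha, alpha * qexp (pi / 3) I)].
Proof.
move=> u2 Lu.
have [v [Lv v0 v_min]] : exists v, [/\ lattice_set L v, v != 0 &
    forall p, lattice_set L p -> p != 0 -> qdot v v <= qdot p p].
  apply: (lattice_min (P := fun q => q != 0)).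
  have [l Ll /(_ 0 0) l0] := lattice_not_plane L 0 0.
  by exists l => //; apply/eqP => lz; apply: l0; rewrite lz !scaler0 addr0.
pose M : set H := [set q | lattice_set L (q * v)].
pose e := v * u * qinv v.
have ev : e * v = v * u by rewrite qmulVK.
have e2 : e * e = e - 1.
  rewrite {2}/e !mulrA ev -!mulrA (mulrA u) u2 mulrBl mul1r mulrBr qmulV//.
  by rewrite mulrA.
have vv0 : 0 < qdot v v by rewrite qdot_gt0.
have M1 : M 1 by rewrite /M/= mul1r.
have MB p q : M p -> M q -> M (p - q) by rewrite /M/= mulrBl; exact: latticeB.
have Me q : M q -> M (q * e).
  by rewrite /M/= -mulrA ev mulrA; exact: Lu.
have M_min q : M q -> q != 0 -> 1 <= qdot q q.
  move=> Mq q0; have := v_min (q * v) Mq; rewrite qmul_eq0 negb_or q0 v0 qdotM => /(_ isT).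
  by rewrite -{1}[qdot v v]mul1r ler_pM2r.
have [a0 [Ma0 a0_out a0_min]] : exists a, [/\ M a, ~ int_eis e a &
    forall q, M q -> ~ int_eis e q -> qdot a a <= qdot q q].
  have [|l [Ll lout lmin]] := lattice_min (L := L) (P := fun l => ~ int_eis e (l * qinv v)).
    have [l Ll lout] := lattice_not_plane L v (e * v).
    exists l => // -[m [n lE]]; apply: (lout m%:~R n%:~R).
    by rewrite -[l](qmulVK _ v0) lE /eis mulrDl -!scalerAl mul1r.
  exists (l * qinv v); split => //; first by rewrite /M/= qmulVK.
  move=> q Mq qout; have := lmin (q * v) Mq; rewrite qmulK// => /(_ qout).
  have -> : qdot l l = qdot (l * qinv v) (l * qinv v) * qdot v v by rewrite -qdotM qmulVK.
  by rewrite (qdotM q) ler_pM2r.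
have [a [Ma a_out a_min a_sign]] : exists a, [/\ M a, ~ int_eis e a,
    forall q, M q -> ~ int_eis e q -> qdot a a <= qdot q q & 0 <= qdot e a].
  have [s|/ltW s] := leP 0 (qdot e a0); first by exists a0.
  exists (- a0); split.
  - by rewrite -sub0r -(subrr 1); apply: (MB _ _ (MB _ _ M1 M1)).
  - move=> [m [n aE]]; apply: a0_out; exists (- m), (- n).
    by rewrite -[a0]opprK aE eisN !intrN.
  - by rewrite qdotNl qdotNr opprK.
  - by rewrite qdotNr oppr_ge0.
have [I II eE] := sixth_root_qexp e2.
exists I, a; rewrite -eE; split => //.
  rewrite -sqrtr1 ler_wsqrtr//; exact: (minimal_norm e2 M1 MB Me M_min Ma a_out).
have MZ := module_eq_zspan e2 M1 MB Me M_min Ma a_out a_min.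
have sp := basis4_special e2 M1 MB Me M_min Ma a_out a_min a_sign.
split => //=.
have fr : free [tuple 1; e; a; a * e] by case: sp.
exists (Lattice (ex_intro _ _ (conj fr erefl))); split => //.
apply: (equivalent_of_scaling (qinv_neq0 v0)) => q /=.
by rewrite -MZ /M/= qmulVK.
Qed.

(** An equivalence multiplies the lattice by some a, and so conjugates the
    symmetry e of Z[e] + alpha Z[e] into a e a^-1. *)
Lemma symmetry_of_modulus L I alpha : imag_units I ->
  is_modulus L (qexp (pi / 3) I, alpha, alpha * qexp (pi / 3) I) ->
  exists u, u * u = u - 1 /\ forall q, lattice_set L (q * u) <-> lattice_set L q.
Proof.
move=> II [_ [L' [/= L'E /biregular_scaling[a a0 La]]]].
set e := qexp (pi / 3) I in L'E.
have e2 : e * e = e - 1 by exact: qexp_pi3.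
have L'e q : lattice_set L' q -> lattice_set L' (q * e).
  rewrite L'E => /zspan4E[m [n [m' [n' ->]]]]; apply/zspan4E.
  exists (- n), (m + n), (- n'), (m' + n').
  have ee x y : eis e x y * e = eis e (- y) (x + y).
    rewrite /eis mulrDl -!scalerAl mul1r e2; apply: quatP => k _.
    by rewrite !(qcoefD, qcoefN, qcoefZ); ring.
  by rewrite mulrDl -mulrA !ee !intrD !intrN.
(* q = q e - q e^2 because e^2 = e - 1 *)
have L'e' q : lattice_set L' (q * e) -> lattice_set L' q.
  move=> Lq; have -> : q = q * e - q * e * e by rewrite -mulrA e2 mulrBr mulr1 opprB addrC subrK.
  by apply: latticeB => //; exact: L'e.
exists (a * e * qinv a); split.
  rewrite !mulrA (qmulVK _ a0) -(mulrA a e) e2 mulrBr mulr1 mulrBl qmulV//.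
move=> q; rewrite -La !mulrA (qmulVK _ a0).
by rewrite -La; split; [exact: L'e'|exact: L'e].
Qed.

Lemma symmetry_Aut L a : S3 a ->
  (forall q, lattice_set L (q * a) <-> lattice_set L q) -> Aut L (fun q => q * a).
Proof.
move=> na La; exists a; split => //; apply/seteqP; split => q.
  by move=> [p /La Lp <-].
have a0 : a != 0.
  apply/eqP => az; move: na; rewrite /S3/= az /qnorm qdot0l sqrtr0 => /eqP.
  by rewrite eq_sym oner_eq0.
by move=> Lq; exists (q * qinv a); [apply/La|]; rewrite qmulVK.
Qed.

Lemma Aut_symmetry L F : Aut L F -> exists a, [/\ a != 0, F = (fun q => q * a) &
  forall q, lattice_set L (q * a) <-> lattice_set L q].
Proof.
move=> [a [na FE FL]].
have a0 : a != 0.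
  apply/eqP => az; move: na; rewrite /S3/= az /qnorm qdot0l sqrtr0 => /eqP.
  by rewrite eq_sym oner_eq0.
exists a; split => // q; split => [|Lq]; rewrite -{1}FL FE.
  by move=> [p Lp /(congr1 (fun x => x * qinv a))]; rewrite !qmulK// => <-.
by exists q.
Qed.

Lemma sixth_root_cube (e : H) : e * e = e - 1 -> e ^+ 3 = -1.
Proof.
move=> e2; rewrite !exprS expr0 mulr1 e2 mulrBr mulr1 e2.
by rewrite addrAC subrr add0r.
Qed.

(** The generator of the given group acts as q -> q a with a of order 6, and in a
    skew field -1 is the only element of order 2. *)
Lemma symmetry_of_subgroup L (I0 : H) : imag_units I0 ->
  has_subgroup_isog (Aut L) (twoC3 I0) ->
  exists u, u * u = u - 1 /\ forall q, lattice_set L (q * u) <-> lattice_set L q.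
Proof.
move=> II0 [K [phi [KA _ [phiK phi_inj _] phiM]]].
pose x0 := qexp (pi / 3) I0.
have x2 : x0 * x0 = x0 - 1 by exact: qexp_pi3.
have Gx k : twoC3 I0 (x0 ^+ k) by exists k.
have AutG k : Aut L (phi (x0 ^+ k)) by apply/KA/phiK.
have [a [a0 phia La]] := Aut_symmetry (AutG 1).
have phi1 : phi 1 = id.
  have [b [b0 phib _]] := Aut_symmetry (AutG 0).
  have := phiM 1 1 (Gx 0) (Gx 0); rewrite mulr1 phib => /(congr1 (fun f => f (qinv b))).
  by rewrite /= (qmulVl b0) mul1r => <-; apply/funext => q; rewrite mulr1.
have phik k : phi (x0 ^+ k) = (fun q => q * a ^+ k).
  elim: k => [|k IH]; first by rewrite expr0 phi1; apply/funext => q; rewrite mulr1.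
  rewrite exprSr (phiM _ _ (Gx k) (Gx 1)) IH phia.
  by apply/funext => q; rewrite /= -mulrA exprS.
have inj k l : a ^+ k = a ^+ l -> x0 ^+ k = x0 ^+ l.
  by move=> akl; apply: phi_inj; rewrite ?inE//; rewrite !phik akl.
have x3 := sixth_root_cube x2.
have m1 : (-1 : H) != 1.
  rewrite -subr_eq0 -opprD oppr_eq0 -mulr2n; apply/eqP => /(congr1 (fun q : H => qcoef q 0)).
  by rewrite mulr2n qcoefD qcoef0 !qcoef1//= => /eqP; rewrite -mulr2n pnatr_eq0.
have a6 : a ^+ 6 = 1.
  have := phik 6; rewrite (exprM x0 3 2) x3 sqrrN expr1n phi1 => /(congr1 (fun f => f 1)).
  by rewrite mul1r.
have a3 : a ^+ 3 = -1.
  have /eqP : (a ^+ 3 - 1) * (a ^+ 3 + 1) = 0.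
    rewrite mulrDr mulr1 mulrBl mul1r -exprD a6 addrA subrK subrr //.
  rewrite qmul_eq0 subr_eq0 addr_eq0 => /orP[|] /eqP // a31; exfalso.
  move/eqP: m1; apply; rewrite -x3 -[RHS](expr0 x0); apply: inj.
  by rewrite a31.
exists a; split => //.
have /eqP : (a + 1) * (a * a - a + 1) = 0.
  have : (a + 1) * (a * a - a + 1) = a ^+ 3 + 1.
    rewrite mulrDl mul1r !mulrDr mulrN mulr1 -[a * (a * a)]/(a ^+ 3).
    move: (a ^+ 3) (a * a) => A B; apply: quatP => k _.
    by rewrite !(qcoefD, qcoefN); ring.
  by rewrite a3 addNr.
rewrite qmul_eq0 addr_eq0 => /orP[/eqP am|/eqP h]; last first.
  apply/eqP; rewrite -subr_eq0; apply/eqP; rewrite -h.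
  by rewrite opprB addrA addrAC.
exfalso; have : x0 ^+ 2 = 1.
  by rewrite -(expr0 x0); apply: inj; rewrite am sqrrN expr1n.
move=> x21; have : x0 = -1 by rewrite -x3 exprSr x21 mul1r.
move=> xm; move: x2; rewrite -expr2 x21 xm => /(congr1 (fun q : H => qcoef q 0)).
rewrite qcoefD !qcoefN !qcoef1//= => h.
have : (0 : R) < 0 by lra.
by rewrite ltxx.
Qed.

(** The plane R + R I0 containing the abstract group maps isomorphically onto the
    plane of u; commutativity there reconciles the order of composition of right
    multiplications with that of the product. *)
Lemma subgroup_of_symmetry L (I0 u : H) : imag_units I0 -> u * u = u - 1 ->
  (forall q, lattice_set L (q * u) <-> lattice_set L q) ->
  has_subgroup_isog (Aut L) (twoC3 I0).
Proof.
move=> II0 u2 Lu.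
have [I1 II1 uE] := sixth_root_qexp u2.
pose x0 := qexp (pi / 3) I0.
have x2 : x0 * x0 = x0 - 1 by exact: qexp_pi3.
have [x0re _ _ _] := sixth_root_coord x2.
(* the algebra isomorphism from R + R I0 onto R + R I1 *)
pose s (q : H) : H := (qcoef q 0)%:A + qdot q I0 *: I1.
pose c (x y : R) (I : H) : H := x%:A + y *: I.
have cM x y x' y' I : imag_units I ->
    c x y I * c x' y' I = c (x * x' - y * y') (x * y' + y * x') I.
  move=> II; have I2 : I * I = -1 by rewrite -expr2.
  rewrite /c mulrDl !mulrDr -!scalerAl -!scalerAr !mul1r !mulr1 I2 !scalerA.
  by apply: quatP => k _; rewrite !(qcoefD, qcoefN, qcoefZ); ring.
have sc x y : s (c x y I0) = c x y I1.
  have [r0 n0] := (imag_unitsP I0).1 II0.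
  rewrite /s /c qcoefD !qcoefZ r0 qcoef1//= qdotDl !qdotZl n0.
  have -> : qdot 1 I0 = 0 by rewrite qdotE !qcoef1//= r0; lra.
  by rewrite !mulr0 !mulr1 addr0 add0r.
have xc k : exists x y, x0 ^+ k = c x y I0.
  elim: k => [|k [x [y IH]]].
    by exists 1, 0; rewrite expr0 /c scale1r scale0r addr0.
  by rewrite exprS IH [x0]/(c _ _ I0) cM//; do 2 eexists.
have sM p q : twoC3 I0 p -> twoC3 I0 q -> s (p * q) = s p * s q.
  move=> [k ->] [l ->]; have [x [y ->]] := xc k; have [x' [y' ->]] := xc l.
  by rewrite cM// !sc cM.
have sx k : s (x0 ^+ k) = u ^+ k.
  elim: k => [|k IH].
    have := sc 1 0; rewrite /c !scale0r !addr0 !scale1r; exact.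
  rewrite !exprS sM ?IH; [|by exists 1%N|by exists k].
  by congr (_ * _); rewrite [x0]/(c _ _ I0) sc uE.
have Luk k q : lattice_set L (q * u ^+ k) <-> lattice_set L q.
  elim: k q => [|k IH] q; first by rewrite mulr1.
  by rewrite exprS mulrA IH.
have x6 : x0 ^+ 6 = 1 by rewrite (exprM x0 3 2) (sixth_root_cube x2) sqrrN expr1n.
have u6 : u ^+ 6 = 1 by rewrite (exprM u 3 2) (sixth_root_cube u2) sqrrN expr1n.
have nu k : S3 (u ^+ k).
  rewrite /S3/= /qnorm; suff -> : qdot (u ^+ k) (u ^+ k) = 1 by rewrite sqrtr1.
  elim: k => [|k IH]; first by rewrite qdot11.
  by rewrite exprS qdotM IH mulr1; have [] := sixth_root_coord u2.
pose phi (x : H) := fun q : H => q * s x.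
exists (phi @` twoC3 I0), phi; split.
- move=> _ [_ [k ->] <-]; rewrite /phi sx; apply: symmetry_Aut; [exact: nu|exact: Luk].
- split.
  + exists 1; first by exists 0%N.
    by apply/funext => q; rewrite /phi -(expr0 x0) sx mulr1.
  + move=> _ _ [_ [k ->] <-] [_ [l ->] <-]; exists (x0 ^+ (l + k)); first by exists (l + k)%N.
    by apply/funext => q; rewrite /phi !sx /= -mulrA exprD.
  + move=> _ [_ [k ->] <-]; exists (phi (x0 ^+ (5 * k))).
      by exists (x0 ^+ (5 * k)) => //; exists (5 * k)%N.
    by split => q; rewrite /phi !sx -mulrA -exprD ?[(5 * k + k)%N]addnC -mulSn exprM u6 expr1n mulr1.
- split.
  + by move=> x Gx; exists x.
  + move=> p q; rewrite !inE => -[k ->] [l ->]; have [x [y ->]] := xc k; have [x' [y' ->]] := xc l.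
    move=> /(congr1 (fun f => f 1)); rewrite /phi !mul1r !sc /c => E.
    have [r1 n1] := (imag_unitsP I1).1 II1.
    have xx : x = x'.
      have := congr1 (fun q : H => qcoef q 0) E.
      by rewrite !qcoefD !qcoefZ r1 !qcoef1//= => h; lra.
    by move: E; rewrite xx => /addrI/eqP; rewrite -subr_eq0 -scalerBl scaler_eq0
      (negbTE (imag_units_neq0 II1)) orbF subr_eq0 => /eqP ->.
  + by move=> F [x Gx <-]; exists x.
- move=> x y Gx Gy; apply/funext => q; rewrite /phi /= -mulrA; congr (q * _).
  case: Gx Gy => k -> [l ->]; rewrite -exprD !sx -exprD; congr (_ ^+ _).
  exact: addnC.
Qed.

End Symmetries.

Theorem proposition8p13 (R : realType) (L : lattice R) (I0 : quat R)
    (hI0 : imag_units I0) :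
  has_subgroup_isog (Aut L) (twoC3 I0) <->
  exists (I alpha3 : quat R),
    [/\ imag_units I, 1 <= qnorm alpha3 &
        is_modulus L (qexp (pi / 3) I, alpha3, alpha3 * qexp (pi / 3) I)].
Proof.
split.
  move=> /(symmetry_of_subgroup hI0)[u [u2 Lu]].
  exact: modulus_of_symmetry u2 (fun q => (Lu q).2).
move=> [I [a [II _ /(symmetry_of_modulus II)[u [u2 Lu]]]]].
exact: (subgroup_of_symmetry hI0 u2 Lu).
Qed.
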